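(* Let $d\ge 1$, $N\ge 1$, $\delta>0$ and assume that $h:(-\pi-\delta,\pi+\delta)\times\mathbb{R}^{d}\rightarrow\mathbb{C}$ is polyharmonic of order $N$ and is odd at $t=0$ and at $t=\pm\pi$. If $$\sup_{t\in[-\pi,\pi]}\left|t\cdot(\pi^{2}-t^{2})\,h(t,y)\right|\leq o\left(|y|^{(1-d)/2}e^{|y|}\right)\quad\text{for }|y|\rightarrow\infty,$$ then $h$ is identically zero.
   Context: A function $f:G\to\mathbb{C}$ on a domain $G$ in a Euclidean space is polyharmonic of order $N$ if it is $2N$ times continuously differentiable and $\Delta^{N}f=0$ on $G$, where $\Delta$ is the Laplace operator in all variables. Here the variables are $(t,y)$ with $y\in\mathbb{R}^d$ and $\Delta=\partial_t^2+\Delta_y$. A function $u:(a,b)\times\mathbb{R}^{d}\to\mathbb{C}$ is odd at $t_{0}\in(a,b)$ if $u(t_{0}+t,y)=-u(t_{0}-t,y)$ for all $|t|<\min\{b-t_{0},t_{0}-a\}$ and all $y\in\mathbb{R}^{d}$. The notation $g(y)\le o(\varphi(|y|))$ for $|y|\to\infty$ (with $g\ge 0$, $\varphi>0$) means $g(y)/\varphi(|y|)\to 0$ as $|y|\to\infty$; $|y|$ is the Euclidean norm. *)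

(* Defs.v *)
From HB Require Import structures.
From mathcomp Require Import all_boot all_order all_algebra.
From mathcomp Require Import all_classical all_reals all_analysis.
From mathcomp Require Import complex.

Set Implicit Arguments.
Unset Strict Implicit.
Unset Printing Implicit Defensive.

Import Order.TTheory GRing.Theory Num.Theory.
Import numFieldNormedType.Exports.

Local Open Scope classical_set_scope.
Local Open Scope ring_scope.

(* [Rcomplex R] is [R[i]] seen as a vector space over [R], normed by the
   [R]-valued modulus.  Its norm topology makes it a [normedModType R], so that
   [derivable] and ['D_v] apply to complex-valued functions of real variables. *)
Section Rcomplex_normedModule.
Variable R : realType.
Local Notation C := (Rcomplex R).

Lemma Rcomplex_normrZ (l : R) (z : C) : `|l *: z| = `|l| * `|z|.
Proof.
case: z => a b; rewrite -sqrtr_sqr -sqrtrM ?sqr_ge0//.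
by congr Num.sqrt; rewrite mulrDr !exprMn.
Qed.

HB.instance Definition _ := PseudoMetric.copy C (pseudoMetric_normed C).
HB.instance Definition _ := isPointed.Build C 0.
HB.instance Definition _ := NormedZmod_PseudoMetric_eq.Build R C erefl.
HB.instance Definition _ :=
  PseudoMetricNormedZmod_Lmodule_isNormedModule.Build R C Rcomplex_normrZ.
End Rcomplex_normedModule.

Section Polyharmonic.
Variables (R : realType) (n : nat).
Local Notation C := (Rcomplex R).
Implicit Types (f : 'rV[R]_n -> C) (G : set 'rV[R]_n).

Definition partial (i : 'I_n) f : 'rV[R]_n -> C := 'D_(delta_mx 0 i) f.

(* All iterated partial derivatives of order at most [k] exist and are
   continuous at the points of [G]; meant for open [G]. *)
Fixpoint continuously_differentiable (k : nat) f G : Prop :=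
  (forall x, G x -> {for x, continuous f}) /\
  if k is k'.+1 then
    forall i : 'I_n,
      (forall x, G x -> derivable f x (delta_mx 0 i)) /\
      continuously_differentiable k' (partial i f) G
  else True.

Definition laplacian f : 'rV[R]_n -> C :=
  fun x => \sum_(i < n) partial i (partial i f) x.

Definition polyharmonic (N : nat) f G : Prop :=
  continuously_differentiable (2 * N) f G /\
  forall x, G x -> iter N laplacian f x = 0.

End Polyharmonic.

Section Strip.
Variables (R : realType) (d : nat).
Local Notation C := (Rcomplex R).

(* The point [(t, y)] of R x R^d is the row vector [row_mx t%:M y]. *)
Definition on_joint (u : R -> 'rV[R]_d -> C) : 'rV[R]_(1 + d) -> C :=
  fun x => u (lsubmx x 0 0) (rsubmx x).

Definition strip (a b : R) : set 'rV[R]_(1 + d) :=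
  [set x | a < lsubmx x 0 0 < b].

Definition odd_at (a b : R) (u : R -> 'rV[R]_d -> C) (t0 : R) : Prop :=
  forall (t : R) (y : 'rV[R]_d), `|t| < Num.min (b - t0) (t0 - a) ->
    u (t0 + t) y = - u (t0 - t) y.

(* The library norm on ['rV[R]_d] is the sup norm. *)
Definition euclidean_norm (y : 'rV[R]_d) : R :=
  Num.sqrt (\sum_(j < d) y 0 j ^+ 2).

(* The filter of the limit |y| -> oo. *)
Definition at_infinity : set_system 'rV[R]_d :=
  filter_from [set: R] (fun M => [set y | M < euclidean_norm y]).

(* [g y <= o(phi |y|)] for |y| -> oo.  [g] is extended-real valued so that
   suprema need no finiteness side condition. *)
Definition le_little_o (g : 'rV[R]_d -> \bar R) (phi : R -> R) : Prop :=
  (g y * ((phi (euclidean_norm y))^-1)%:E)%E @[y --> at_infinity] --> 0%E.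

End Strip.

(* Main.v *)
Require Import Defs.
From HB Require Import structures.
From mathcomp Require Import all_boot all_order all_algebra.
From mathcomp Require Import all_classical all_reals all_analysis.
From mathcomp Require Import complex.
From mathcomp Require Import ring lra.

Set Implicit Arguments.
Unset Strict Implicit.
Unset Printing Implicit Defensive.

Import Order.TTheory GRing.Theory Num.Theory.
Import numFieldNormedType.Exports.

Local Open Scope classical_set_scope.
Local Open Scope ring_scope.

(** Why the theorem holds.

    By oddness [h] and its iterated Laplacians vanish for t = 0 and t = pi, and
    oddness carries [h = 0] from the slab 0 <= t <= pi to the whole strip.  The
    real and the imaginary part are treated separately; let f be one of them.
    Every estimate is obtained from the maximum principle ([max_principle]) by
    means of explicit comparison functions.

    Suppose first that f is harmonic.  Put
      s = sqrt ((d + 1) ^ 2 + |y| ^ 2),   U(y) = s ^ ((1 - d) / 2) e ^ s.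
    Up to constants U has the growth rate of the theorem, and lap U < U
    ([weight_supersolution]), so W = U sin t satisfies lap W < 0 in the slab.  If
    f is o(W), then f - e W is nonpositive on the faces and far out and has a
    positive Laplacian, hence f <= e W for every e > 0 and f <= 0
    ([phragmen_lindelof]); the same holds for - f.  The hypothesis bounds f only
    by o(U) / (t (pi - t)), which is singular where W vanishes.  But a harmonic
    function that vanishes on a face and is O(t ^ -q) near it is in fact O(t),
    with the corresponding constants ([boundary_decay]).

    For higher order, let g be the Laplacian of f.  It is bounded at each point
    by the supremum of |f| over a cube around that point, divided by the square
    of the size of the cube ([laplacian_interior_bound], which rests on the
    inequality [interpolation] of Bernstein type).  With cubes of size
    proportional to t (pi - t), the function g satisfies a growth condition like
    that of f, with the factor (t (pi - t)) ^ (q + 2) instead of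
    (t (pi - t)) ^ q.  An induction on the order, for all exponents q at once,
    yields g = 0, so that f is harmonic ([polyharmonic_strip_eq0]). *)

(** * Pointwise continuity of real functions *)

Section PointwiseContinuity.
Variables (R : realType) (T : topologicalType) (x : T) (u v : T -> R).
Hypotheses (uc : {for x, continuous u}) (vc : {for x, continuous v}).

Lemma continuous_forD : {for x, continuous (fun z => u z + v z)}.
Proof. exact: continuousD. Qed.

Lemma continuous_forM : {for x, continuous (fun z => u z * v z)}.
Proof. exact: continuousM. Qed.

Lemma continuous_forN : {for x, continuous (fun z => - u z)}.
Proof. exact: continuousN. Qed.

Lemma continuous_for_norm : {for x, continuous (fun z => `|u z|)}.
Proof.
apply: (@continuous_comp _ _ _ u (fun y : R => `|y|)) => //.
exact: norm_continuous.
Qed.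

Lemma continuous_for_cst (c : R) : {for x, continuous (fun=> c : R)}.
Proof. exact: cst_continuous. Qed.

End PointwiseContinuity.

Lemma continuous_forX (R : realType) (T : topologicalType) (x : T) (u : T -> R)
  (m : nat) : {for x, continuous u} -> {for x, continuous (fun z => u z ^+ m)}.
Proof.
move=> uc; apply: (@continuous_comp _ _ _ u (fun y : R => y ^+ m)) => //.
exact: exprn_continuous.
Qed.

(** * Second-order jets along a direction *)

Section Jets.
Variables (R : realType) (V : normedModType R).
Implicit Types (f g : V -> R) (x z e v : V).

(** Through this equivalence the one-variable theorems (chain rule, mean value
    theorem, extremum test) apply to directional derivatives. *)
Lemma is_derive_line f x v (s p : R) :
  is_derive (s *: v + x) v f p <->
  is_derive s 1 (fun h : R => f (h *: v + x)) p.
Proof.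
have E : (fun h : R => h^-1 *: ((f \o shift (s *: v + x)) (h *: v)
                                - f (s *: v + x)))
   = (fun h : R => h^-1 *: (((fun k : R => f (k *: v + x)) \o shift s)
                              (h *: (1 : R)) - f (s *: v + x))).
  by apply/funext => h /=; rewrite addrA -scalerDl [h *: (1 : R)]mulr1.
by split=> -[d D]; split; rewrite /derivable /derive ?E -?E // -?D /derive ?E.
Qed.

Lemma is_derive_comp_dir f x v (G : R -> R) (p q : R) :
  is_derive x v f p -> is_derive (f x) 1 G q -> is_derive x v (G \o f) (q * p).
Proof.
move=> fp Gq; have x0 : x = 0 *: v + x by rewrite scale0r add0r.
rewrite x0; apply/is_derive_line.
apply: (@is_derive1_comp R G (fun h : R => f (h *: v + x))).
  by rewrite scale0r add0r.
by apply/is_derive_line; rewrite -x0.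
Qed.

(** The first two derivatives of [f] at [x] in the direction [e].  With numbers
    [p] and [q] in place of derivative functions, the jet of a compound function
    is a polynomial in the jets of its parts, and the computation of a Laplacian
    becomes algebra in [R]. *)
Definition jet f x e (p q : R) := exists f' : V -> R,
  [/\ \forall z \near x, is_derive z e f (f' z), f' x = p
    & is_derive x e f' q].

Lemma jet_eq f x e p q p' q' :
  jet f x e p' q' -> p' = p -> q' = q -> jet f x e p q.
Proof. by move=> ? <- <-. Qed.

Lemma jet_near f g x e p q :
  (\forall z \near x, f z = g z) -> jet f x e p q -> jet g x e p q.
Proof.
move=> fg [f' [f'1 f'x f'2]]; exists f'; split=> //.
by apply: filterS2 f'1 (near_join fg) => z fz fgz; exact: near_eq_is_derive fz.
Qed.

Lemma jet_unique f x e p q p' q' :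
  jet f x e p q -> jet f x e p' q' -> p = p' /\ q = q'.
Proof.
move=> [f' [f'1 <- f'2]] [g' [g'1 <- g'2]].
have fg : \forall z \near x, f' z = g' z.
  by apply: filterS2 f'1 g'1 => z [_ <-] [_ <-].
split; first exact: nbhs_singleton fg.
by case: f'2 => _ <-; case: g'2 => _ <-; exact: near_eq_derive.
Qed.

Lemma jet_affine f x e (c : R) : (forall z, is_derive z e f c) -> jet f x e c 0.
Proof.
move=> fc; exists (fun=> c); split=> //; last exact: is_derive_cst.
exact: nearW.
Qed.

Lemma jet_cst (c : R) x e : jet (fun=> c) x e 0 0.
Proof. exact: jet_affine (fun z => is_derive_cst _ _ _). Qed.

Lemma jetD f g x e p q p' q' : jet f x e p q -> jet g x e p' q' ->
  jet (fun z => f z + g z) x e (p + p') (q + q').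
Proof.
move=> [f' [f'1 <- f'2]] [g' [g'1 <- g'2]]; exists (fun z => f' z + g' z).
split=> //; last exact: is_deriveD.
by apply: filterS2 f'1 g'1 => z fz gz; exact: is_deriveD.
Qed.

Lemma jetM f g x e p q p' q' : jet f x e p q -> jet g x e p' q' ->
  jet (fun z => f z * g z) x e (f x * p' + g x * p)
      (f x * q' + 2 * p * p' + g x * q).
Proof.
move=> [f' [f'1 <- f'2]] [g' [g'1 <- g'2]].
exists (fun z => f z * g' z + g z * f' z); split=> //.
  by apply: filterS2 f'1 g'1 => z fz gz; exact: is_deriveM.
have fx := nbhs_singleton f'1; have gx := nbhs_singleton g'1.
apply: is_derive_eq (is_deriveD (is_deriveM fx g'2) (is_deriveM gx f'2)) _.
by rewrite /GRing.scale /=; ring.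
Qed.

Lemma jetZ (c : R) f x e p q :
  jet f x e p q -> jet (fun z => c * f z) x e (c * p) (c * q).
Proof. by move=> fj; apply: jet_eq (jetM (jet_cst c x e) fj) _ _; ring. Qed.

Lemma jet_sum (I : Type) (r : seq I) (f : I -> V -> R) x e (p q : I -> R) :
  (forall k, jet (f k) x e (p k) (q k)) ->
  jet (fun z => \sum_(k <- r) f k z) x e (\sum_(k <- r) p k)
      (\sum_(k <- r) q k).
Proof.
move=> H; elim: r => [|k r IH].
  rewrite !big_nil; under eq_fun do rewrite big_nil; exact: jet_cst.
rewrite !big_cons; under eq_fun do rewrite big_cons; exact: jetD.
Qed.

Lemma jet_comp (G G' : R -> R) (G2 : R) f x e p q : jet f x e p q ->
  (\forall z \near x, is_derive (f z) 1 G (G' (f z))) ->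
  is_derive (f x) 1 G' G2 ->
  jet (G \o f) x e (G' (f x) * p) (G2 * p ^+ 2 + G' (f x) * q).
Proof.
move=> [f' [f'1 <- f'2]] G1 G'2.
exists (fun z => (G' \o f) z * f' z); split=> //.
  apply: filterS2 f'1 G1 => z fz Gz; exact: is_derive_comp_dir.
have fx := nbhs_singleton f'1.
apply: is_derive_eq (is_deriveM (is_derive_comp_dir fx G'2) f'2) _.
by rewrite /GRing.scale /=; ring.
Qed.

Lemma jet_comp_total (G G' : R -> R) (G2 : R) f x e p q : jet f x e p q ->
  (forall z, is_derive (f z) 1 G (G' (f z))) -> is_derive (f x) 1 G' G2 ->
  jet (G \o f) x e (G' (f x) * p) (G2 * p ^+ 2 + G' (f x) * q).
Proof. by move=> fj Gz; apply: jet_comp fj _; exact: nearW. Qed.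

(** [T] maps each line of direction [e] to a line of the same direction, run
    through with speed [s]. *)
Lemma is_derive_reflect f (T : V -> V) z e (s p : R) :
  (forall h y, T (h *: e + y) = (s * h) *: e + T y) ->
  is_derive (T z) e f p -> is_derive z e (f \o T) (s * p).
Proof.
move=> TE fp; have z0 : z = 0 *: e + z by rewrite scale0r add0r.
rewrite z0; apply/is_derive_line.
rewrite (_ : (fun h : R => _) = (fun k : R => f (k *: e + T z)) \o ( *%R s)).
  rewrite mulrC; apply: is_derive1_comp.
    by apply/is_derive_line; rewrite mulr0 scale0r add0r.
  by apply: is_derive_eq (is_deriveZ s (is_derive_id _ _)) _; rewrite [LHS]mulr1.
by apply/funext => h /=; rewrite TE.
Qed.

Lemma jet_reflect f (T : V -> V) x e (s p q : R) : {for x, continuous T} ->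
  (forall h y, T (h *: e + y) = (s * h) *: e + T y) -> s * s = 1 ->
  jet f (T x) e p q -> jet (f \o T) x e (s * p) q.
Proof.
move=> Tc TE ss [f' [f'1 <- f'2]]; exists (fun z => s * f' (T z)); split=> //.
  have T1 : \forall z \near x, is_derive (T z) e f (f' (T z)) := Tc _ f'1.
  by apply: filterS T1 => z; exact: is_derive_reflect.
rewrite -[q]mul1r -ss -mulrA.
exact: is_deriveZ (is_derive_reflect TE f'2).
Qed.

(** If the second derivative were positive, the first one, which vanishes at
    [x], would be positive just after [x], and [f] would increase there by the
    mean value theorem. *)
Lemma jet_local_max f x e p q : jet f x e p q ->
  (\forall z \near x, f z <= f x) -> q <= 0.
Proof.
move=> [f' [f'1 f'x f'2]] fmax; rewrite leNgt; apply/negP => q0.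
pose phi (h : R) := f (h *: e + x); pose phi' (h : R) := f' (h *: e + x).
have linec : (fun h : R => h *: e + x) @ (0 : R) --> x.
  rewrite -[in X in _ --> X](add0r x) -(scale0r e).
  by apply: cvgD; [apply: cvgZr_tmp; exact: cvg_id|exact: cvg_cst].
have d1 : \forall h \near (0 : R),
    is_derive (h : R) 1 phi (phi' h) /\ phi h <= phi 0.
  have near0 : \forall h \near (0 : R),
      is_derive (h *: e + x) e f (phi' h) /\ phi h <= f x.
    exact: linec _ (filterI f'1 fmax).
  apply: filterS near0 => h [fh mh]; split.
    by apply/is_derive_line.
  by rewrite /phi scale0r add0r.
have d2 : is_derive (0 : R) 1 phi' q.
  by apply/is_derive_line; rewrite scale0r add0r.
have /nbhs_ballP[r /= r0 rP] := d1.
have rP' t : t \in `]-r, r[%R ->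
    is_derive (t : R) 1 phi (phi' t) /\ phi t <= phi 0.
  by rewrite in_itv/= => tr; apply: rP; rewrite /ball/= sub0r normrN ltr_norml.
have z0 : (0 : R) \in `]-r, r[%R by rewrite in_itv/= oppr_lt0 r0.
have phi'0 : phi' 0 = 0.
  have rr : - r <= r by rewrite (@le_trans _ _ 0) ?oppr_le0 ?ltW.
  have [_ D1] : is_derive (0 : R) 1 phi 0.
    by apply: (derive1_at_max rr) => // t /rP'[] // [].
  by case: (rP' _ z0) => -[_ <-] _; rewrite D1.
(* the difference quotients of [phi'] at 0 *)
have kq : (fun h : R => h^-1 * phi' h) @ (0 : R)^' --> q.
  case: d2 => d2 <-; have := d2; rewrite /derivable /derive.
  rewrite (_ : (fun h : R => h^-1 *: _) = (fun h => h^-1 * phi' h)) //.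
  by apply/funext => h /=; rewrite phi'0 subr0 addr0 [_%:A]mulr1.
have kn : \forall h \near (0 : R), h != 0 -> 0 < h^-1 * phi' h.
  exact: cvgr_gt _ kq _ q0.
have /nbhs_ballP[s /= s0 sP] := kn.
pose h := Num.min r s / 2.
have h0 : 0 < h by rewrite divr_gt0 // lt_min r0.
have [hr hs] : h < r /\ h < s.
  have : h < Num.min r s by rewrite ltr_pdivrMr // ltr_pMr ?lt_min ?r0 ?ltr1n.
  by rewrite lt_min => /andP[].
have inr t : 0 <= t <= h -> t \in `]-r, r[%R.
  by move=> /andP[t0 th]; rewrite in_itv/= (le_lt_trans th)// andbT; lra.
have [||c] := @MVT R phi phi' 0 h h0.
- move=> t /[!in_itv]/= /andP[t0 th].
  by apply: (rP' _ _).1; apply: inr; rewrite !ltW.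
- apply: continuous_in_subspaceT => t /[!inE]/= /[!in_itv]/= tr.
  apply: differentiable_continuous; apply/derivable1_diffP.
  by have [[]] := rP' _ (inr _ tr).
rewrite in_itv/= subr0 => /andP[c0 ch] E.
have : 0 < phi' c.
  have : 0 < c^-1 * phi' c.
    apply: sP; last by rewrite gt_eqF.
    by rewrite /ball/= sub0r normrN gtr0_norm // (lt_trans ch).
  by rewrite pmulr_rgt0 // invr_gt0.
have /rP'[_] : h \in `]-r, r[%R by apply: inr; rewrite (ltW h0) /=.
by rewrite -subr_le0 E pmulr_lle0 // leNgt => /negbTE ->.
Qed.

Lemma continuous_sum_squares (I : finType) (w c : I -> R) (l : I -> V -> R) :
  (forall j, continuous (l j)) ->
  continuous (fun z : V => \sum_j w j * (l j z - c j) ^+ 2).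
Proof.
move=> lc x; apply: cvg_big => [|j _]; first exact: add_continuous.
have lcx : (fun z => l j z - c j) @ x --> l j x - c j.
  by apply: cvgB; [exact: lc|exact: cvg_cst].
by under eq_fun do rewrite expr2; rewrite expr2;
  apply: cvgM; [exact: cvg_cst|exact: cvgM].
Qed.

End Jets.

(** * Laplacian at a point and the maximum principle *)

Section Laplace.
Variables (R : realType) (n : nat).
Local Notation V := 'rV[R]_n.
Implicit Types (f g w : V -> R) (x c : V) (G K : set V).

Definition basis_vector (i : 'I_n) : V := delta_mx 0 i.
Local Notation ev := basis_vector.

Lemma jet_coord (j i : 'I_n) x :
  jet (fun z : V => z 0 j) x (ev i) (j == i)%:R 0.
Proof.
apply: jet_affine => z.
have z0 : z = 0 *: ev i + z by rewrite scale0r add0r.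
rewrite [X in is_derive X]z0; apply/is_derive_line.
rewrite (_ : (fun h : R => _) = (fun h : R => h * (j == i)%:R + z 0 j)).
  apply: is_derive_eq.
  by rewrite scaler0 add0r addr0 [_ *: _]mulr1.
by apply/funext => h; rewrite !mxE eqxx.
Qed.

(** A relation rather than a function: it includes the existence of the pure
    second derivatives. *)
Definition laplace_at f x (l : R) := exists p q : 'I_n -> R,
  (forall i, jet f x (ev i) (p i) (q i)) /\ \sum_i q i = l.

Lemma laplace_at_unique f x l l' :
  laplace_at f x l -> laplace_at f x l' -> l = l'.
Proof.
move=> [p [q [fj <-]]] [p' [q' [fj' <-]]]; apply: eq_bigr => i _.
by have [] := jet_unique (fj i) (fj' i).
Qed.

Lemma laplace_at_near f g x l :
  (\forall z \near x, f z = g z) -> laplace_at f x l -> laplace_at g x l.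
Proof.
move=> fg [p [q [fj ql]]]; exists p, q; split=> // i; exact: jet_near (fj i).
Qed.

Lemma laplace_atD f g x l m : laplace_at f x l -> laplace_at g x m ->
  laplace_at (fun z => f z + g z) x (l + m).
Proof.
move=> [p [q [fj <-]]] [p' [q' [gj <-]]].
exists (fun i => p i + p' i), (fun i => q i + q' i); split.
  by move=> i; exact: jetD.
by rewrite big_split.
Qed.

Lemma laplace_atZ (k : R) f x l : laplace_at f x l ->
  laplace_at (fun z => k * f z) x (k * l).
Proof.
move=> [p [q [fj <-]]]; exists (fun i => k * p i), (fun i => k * q i); split.
  by move=> i; exact: jetZ.
by rewrite mulr_sumr.
Qed.

Lemma laplace_atN f x l : laplace_at f x l ->
  laplace_at (fun z => - f z) x (- l).
Proof.
move=> fl; have := laplace_atZ (- 1) fl; rewrite mulN1r.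
by under eq_fun do rewrite mulN1r.
Qed.

(** Squared distances, cut-offs and barriers below are all of this form. *)
Definition quad (w : 'I_n -> R) c x := \sum_j w j * (x 0 j - c 0 j) ^+ 2.

Lemma jet_quad (w : 'I_n -> R) c x i :
  jet (quad w c) x (ev i) (2 * w i * (x 0 i - c 0 i)) (2 * w i).
Proof.
have J j : jet (fun z : V => w j * (z 0 j - c 0 j) ^+ 2) x (ev i)
    (if j == i then 2 * w j * (x 0 j - c 0 j) else 0)
    (if j == i then 2 * w j else 0).
  have J1 := jetD (jet_coord j i x) (jet_cst (- c 0 j) x (ev i)).
  have -> : (fun z : V => w j * (z 0 j - c 0 j) ^+ 2) =
      (fun z : V => w j * ((z 0 j - c 0 j) * (z 0 j - c 0 j))).
    by apply/funext => z; rewrite expr2.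
  apply: jet_eq (jetZ (w j) (jetM J1 J1)) _ _; case: eqP => _ /=; ring.
by apply: jet_eq (jet_sum (index_enum _) J) _ _;
  rewrite -big_mkcond /= big_pred1_eq.
Qed.

Lemma quad_continuous (w : 'I_n -> R) c : continuous (quad w c).
Proof.
apply: continuous_sum_squares => j; exact: coord_continuous.
Qed.

Definition box (a b : 'I_n -> R) := [set x : V | forall i, a i <= x 0 i <= b i].

Lemma box_compact (a b : 'I_n -> R) : compact (box a b).
Proof.
rewrite (_ : box a b = [set v | forall i, `[a i, b i]%classic (v ord0 i)]).
  apply: (@rV_compact R n (fun i => `[a i, b i]%classic)) => i.
  exact: segment_compact.
by apply/seteqP; split=> v vP i; have := vP i; rewrite /= in_itv.
Qed.

Lemma box_nbhs (a b : 'I_n -> R) x :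
  (forall i, a i < x 0 i < b i) -> nbhs x (box a b).
Proof.
move=> xP.
apply: (@filter_forall V _ (fun i => [set z : V | a i <= z 0 i <= b i])
  (nbhs x) (nbhs_filter x)).
move=> i; have /andP[ax xb] := xP i.
have cz : (fun z : V => z 0 i) @ x --> x 0 i := @coord_continuous R 1 n 0 i x.
apply: (@filterS2 _ (nbhs x) (nbhs_filter x)) (cvgr_ge _ cz _ ax)
  (cvgr_le _ cz _ xb) => z az zb.
by apply/andP.
Qed.

(** A positive maximum would be interior, and the pure second derivatives are
    nonpositive there, which contradicts the strict sign of the Laplacian. *)
Lemma max_principle K w : compact K ->
  (forall x, K x -> {for x, continuous w}) ->
  (forall x, K x -> 0 < w x ->
    nbhs x K /\ exists2 l, laplace_at w x l & 0 < l) ->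
  forall x, K x -> w x <= 0.
Proof.
move=> Kc wc wP x Kx.
have [|z /[!inE] Kz zmax] := compact_EVT_max (f := w) (ex_intro _ x Kx) Kc.
  by apply: continuous_in_subspaceT => y /[!inE]; exact: wc.
have [wz|/(wP _ Kz)[Knz [l [p [q [wj <-]]]]]] := leP (w z) 0.
  by apply: le_trans wz; apply: zmax; rewrite inE.
rewrite ltNge sumr_le0 // => i _; apply: jet_local_max (wj i) _.
apply: (@filterS _ (nbhs z) (nbhs_filter z)) Knz => y Ky.
by apply: zmax; rewrite inE; exact: Ky.
Qed.

(** The successive Laplacians are quantified one level at a time, so that an
    induction on the order peels off the first of them. *)
Fixpoint polyharmonic_chain (N : nat) f G : Prop :=
  (forall x, G x -> {for x, continuous f}) /\
  if N is N'.+1 then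
    exists2 g, (forall x, G x -> laplace_at f x (g x)) & polyharmonic_chain N' g G
  else forall x, G x -> f x = 0.

End Laplace.

(** * An interpolation inequality for the Laplacian *)

Section Interpolation.
Variables (R : realType) (n : nat).
Local Notation V := 'rV[R]_n.
Local Notation ev := (@basis_vector R n).
Implicit Types (f g k w : V -> R) (x c : V).

Lemma norm_coord x i : `|x 0 i| <= `|x|.
Proof.
rewrite [leRHS]/Num.norm /= mx_normrE.
by apply: (@le_bigmax _ _ _ _ (fun ij : 'I_1 * 'I_n => `|x ij.1 ij.2|) (0, i)).
Qed.

Lemma norm_le_coord x r : 0 <= r -> (forall i, `|x 0 i| <= r) -> `|x| <= r.
Proof.
move=> r0 xr; rewrite [leLHS]/Num.norm /= mx_normrE.
by apply/bigmax_leP; split=> // -[i j] _ /=; rewrite (ord1 i).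
Qed.

Definition sqdist c x := quad (fun=> 1 : R) c x.

Lemma sqdist_ge0 c x : 0 <= sqdist c x.
Proof. by apply: sumr_ge0 => i _; rewrite mul1r sqr_ge0. Qed.

Lemma sqdistxx c : sqdist c c = 0.
Proof. by rewrite /sqdist /quad big1 // => i _; rewrite subrr expr0n mulr0. Qed.

Lemma sqdist_coord c x i : (x 0 i - c 0 i) ^+ 2 <= sqdist c x.
Proof.
rewrite /sqdist /quad (bigD1 i) //= mul1r lerDl.
by apply: sumr_ge0 => j _; rewrite mul1r sqr_ge0.
Qed.

Lemma sqdist_norm c x r : 0 <= r -> sqdist c x <= r ^+ 2 -> `|x - c| <= r.
Proof.
move=> r0 xr; apply: norm_le_coord => // i; rewrite !mxE.
rewrite -(ger0_norm r0) -ler_sqr ?nnegrE ?normr_ge0 // !real_normK ?num_real //.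
exact: le_trans (sqdist_coord c x i) xr.
Qed.

Lemma sqdist_compact c r : 0 <= r -> compact [set x | sqdist c x <= r ^+ 2].
Proof.
move=> r0; pose B := box (fun i => c 0 i - r) (fun i => c 0 i + r).
apply: (subclosed_compact _ (box_compact (a := fun i => c 0 i - r)
                                      (b := fun i => c 0 i + r))).
  apply: (@closed_comp _ _ (sqdist c) [set y : R | y <= r ^+ 2]).
    by move=> x _; exact: quad_continuous.
  exact: closed_le.
move=> x /(sqdist_norm r0) xr i.
have := le_trans (norm_coord (x - c) i) xr.
by rewrite !mxE ler_distlC => /andP[xl xu]; apply/andP; split; lra.
Qed.

Lemma sqdist_nbhs c x r : sqdist c x < r -> nbhs x [set y | sqdist c y <= r].
Proof.
move=> xr.
have Qc : sqdist c @ x --> sqdist c x := @quad_continuous R n _ c x.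
exact: cvgr_le _ Qc _ xr.
Qed.

(** This is the part quadratic in f, g and their first derivatives of what
    results from differentiating twice, in one coordinate, the auxiliary
    function of [interpolation]: there [F] is f, [X] is eta ^ 2 g, [Y] and [Z]
    are eta f' and eta ^ 3 g', [e] is eta' and [c] is eta eta''.  The square
    of [Y] has the coefficient [2 * a], with [a] so large that it absorbs what
    [b] multiplies, and the square of [Z] absorbs the other products.  The
    coefficient of the square of [X] that is left over does not involve [b]. *)
Lemma interpolation_form (a b F X Y Z e c : R) :
  a = 68 * b ^+ 2 -> e ^+ 2 <= 4 -> -2 <= c <= 0 ->
  - 590 * X ^+ 2 - (68 * a + 832 * b ^+ 2) * F ^+ 2 <=
    a * (F ^+ 2 * (2 * e ^+ 2 + 2 * c) + 8 * F * e * Y + 2 * Y ^+ 2)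
  + b * (F * X * (12 * e ^+ 2 + 4 * c) + 8 * (F * e * Z + X * e * Y)
         + 2 * Y * Z)
  + (X ^+ 2 * (30 * e ^+ 2 + 6 * c) + 24 * X * e * Z + 2 * Z ^+ 2).
Proof.
move=> aE e4 /andP[c2 c0].
have sq (u v : R) : - (u ^+ 2 + v ^+ 2) / 2 <= u * v.
  by have := sqr_ge0 (u + v); nra.
have a0 : 0 <= a by rewrite aE mulr_ge0 ?sqr_ge0.
have e0 : 0 <= e ^+ 2 := sqr_ge0 e.
have scale (A u v : R) : 0 <= A -> u <= v -> A * u <= A * v.
  by move=> A0 uv; rewrite ler_wpM2l.
have F2 := sqr_ge0 F; have X2 := sqr_ge0 X.
have h1 : - 68 * F ^+ 2 + Y ^+ 2 <=
    F ^+ 2 * (2 * e ^+ 2 + 2 * c) + 8 * F * e * Y + 2 * Y ^+ 2.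
  have := sqr_ge0 (4 * (F * e) + Y).
  have : F ^+ 2 * e ^+ 2 <= F ^+ 2 * 4 by rewrite ler_wpM2l.
  have : F ^+ 2 * (-2) <= F ^+ 2 * c by rewrite ler_wpM2l.
  have : 0 <= F ^+ 2 * e ^+ 2 by rewrite mulr_ge0.
  have -> : (F ^+ 2 * e ^+ 2) = (F * e) ^+ 2 by rewrite exprMn.
  by nra.
have h1' := ler_wpM2l a0 h1.
have h2 : - 588 * X ^+ 2 + Z ^+ 2 <=
    X ^+ 2 * (30 * e ^+ 2 + 6 * c) + 24 * X * e * Z + 2 * Z ^+ 2.
  have := sqr_ge0 (12 * (X * e) + Z).
  have : X ^+ 2 * e ^+ 2 <= X ^+ 2 * 4 by rewrite ler_wpM2l.
  have : X ^+ 2 * (-2) <= X ^+ 2 * c by rewrite ler_wpM2l.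
  have : 0 <= X ^+ 2 * e ^+ 2 by rewrite mulr_ge0.
  have -> : (X ^+ 2 * e ^+ 2) = (X * e) ^+ 2 by rewrite exprMn.
  by nra.
set m := 12 * e ^+ 2 + 4 * c.
have m2 : m ^+ 2 <= 48 ^+ 2.
  have : -48 <= m <= 48 by rewrite /m; apply/andP; split; lra.
  by move=> /andP[m1 m3]; nra.
have h3 : - X ^+ 2 - 576 * b ^+ 2 * F ^+ 2 <= b * (F * X * m).
  have := sqr_ge0 (X + b * F * m / 2).
  have : (b * F) ^+ 2 * m ^+ 2 <= (b * F) ^+ 2 * 48 ^+ 2.
    by rewrite ler_wpM2l ?sqr_ge0.
  by nra.
have h4 : - Z ^+ 2 / 4 - 256 * b ^+ 2 * F ^+ 2 <= b * (8 * (F * e * Z)).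
  have := sqr_ge0 (Z / 2 + 8 * b * F * e).
  have : (b * F) ^+ 2 * e ^+ 2 <= (b * F) ^+ 2 * 4 by rewrite ler_wpM2l ?sqr_ge0.
  by nra.
have h5 : - X ^+ 2 - 64 * b ^+ 2 * Y ^+ 2 <= b * (8 * (X * e * Y)).
  have := sqr_ge0 (X + 4 * b * e * Y).
  have : (b * Y) ^+ 2 * e ^+ 2 <= (b * Y) ^+ 2 * 4 by rewrite ler_wpM2l ?sqr_ge0.
  by nra.
have h6 : - Z ^+ 2 / 4 - 4 * b ^+ 2 * Y ^+ 2 <= b * (2 * Y * Z).
  by have := sqr_ge0 (Z / 2 + 2 * b * Y); nra.
have aY : a * Y ^+ 2 = 68 * b ^+ 2 * Y ^+ 2 by rewrite aE.
have Z2 := sqr_ge0 Z.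
have -> : b * (F * X * m + 8 * (F * e * Z + X * e * Y) + 2 * Y * Z) =
  b * (F * X * m) + b * (8 * (F * e * Z)) + b * (8 * (X * e * Y)) + b * (2 * Y * Z).
  by ring.
have a1 : a * (- 68 * F ^+ 2 + Y ^+ 2) = - 68 * a * F ^+ 2 + a * Y ^+ 2 by ring.
by lra.
Qed.

(** Bernstein's method.  Let [g] be the Laplacian of [f] and [k] that of [g],
    and let [eta] be a cut-off that vanishes on the sphere of radius [r].  In
    the Laplacian of
      P = a (eta f) ^ 2 + b (eta ^ 2 f) (eta ^ 2 g) + (eta ^ 3 g) ^ 2
    the first and last terms produce squares of gradients, which absorb the
    mixed terms, and the middle one produces b (eta ^ 2 g) ^ 2.  For [b] large
    this gives lap P >= - K with [K] a multiple of the right-hand side.  The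
    maximum principle compares P with K (r ^ 2 - |x - c| ^ 2), and the value at
    [c] bounds [g c].  The powers of [eta] are those for which all terms scale
    alike, which is why [C] does not depend on [r]. *)
Lemma interpolation : (0 < n)%N -> exists2 C : R, 0 < C &
  forall f g k c (r S0 S2 : R), 0 < r -> 0 < S0 ->
  (forall x, `|x - c| <= r -> {for x, continuous f} /\ {for x, continuous g}) ->
  (forall x, `|x - c| <= r -> [/\ laplace_at f x (g x), laplace_at g x (k x),
      `|f x| <= S0 & `|k x| <= S2]) ->
  g c ^+ 2 * r ^+ 4 <= C * (S0 ^+ 2 + r ^+ 8 * S2 ^+ 2).
Proof.
move=> n0; have n1 : 1 <= n%:R :> R by rewrite ler1n.
(* [592 * n%:R] exceeds the total coefficient of [X ^+ 2] left over by
   [interpolation_form], summed over the [n] coordinates, by [2 * n%:R]. *)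
have [b [bE b0]] : exists b : R, b = 592 * n%:R /\ 0 < b.
  by exists (592 * n%:R); split; [reflexivity|lra].
have [a [aE a0]] : exists a : R, a = 68 * b ^+ 2 /\ 0 < a.
  by exists (68 * b ^+ 2); split; [reflexivity|have := exprn_gt0 2 b0; lra].
have [C1 [C1E C10]] : exists C1 : R,
    C1 = n%:R * (68 * a + 832 * b ^+ 2) + a ^+ 2 + b ^+ 2 + 2 /\ 2 <= C1.
  eexists; split; first reflexivity.
  have a2 := sqr_ge0 a; have b2 := sqr_ge0 b.
  have : 0 <= n%:R * (68 * a + 832 * b ^+ 2) by apply: mulr_ge0; lra.
  by lra.
exists (2 * C1); first by lra.
move=> f g k c r S0 S2 r0 S00 cH H.
have rn0 : r != 0 by rewrite gt_eqF.
pose w0 : 'I_n -> R := fun=> - r^-1.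
(* dividing by [r] makes the gradient of [eta] bounded independently of [r] *)
pose eta x := r + quad w0 c x.
have etaE x : eta x = (r ^+ 2 - sqdist c x) / r.
  rewrite /eta /sqdist /quad mulrBl expr2 mulfK // mulr_suml -sumrN.
  by congr (_ + _); apply: eq_bigr => i _; rewrite /w0; field.
pose K := C1 * (S0 ^+ 2 + r ^+ 8 * S2 ^+ 2).
have K0 : 0 < K.
  rewrite mulr_gt0 ?(lt_le_trans _ C10) // ltr_pwDl ?exprn_gt0 //.
  by rewrite mulr_ge0 ?sqr_ge0 // exprn_ge0 // ltW.
pose P x := a * ((eta x * f x) * (eta x * f x))
  + b * ((eta x * eta x * f x) * (eta x * eta x * g x))
  + (eta x * eta x * eta x * g x) * (eta x * eta x * eta x * g x).
pose w x := P x + K * (sqdist c x - r ^+ 2).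
have inball x : sqdist c x <= r ^+ 2 -> `|x - c| <= r.
  by move=> ?; apply: sqdist_norm => //; exact: ltW.
have eta_cont x : {for x, continuous eta}.
  by apply: continuousD; [exact: cst_continuous|exact: quad_continuous].
suff : w c <= 0.
  rewrite /w /P sqdistxx etaE sqdistxx subr0 expr2 mulfK // sub0r => h.
  set F := f c in h; set g0 := g c in h *.
  have : r ^+ 2 *
      (a * F ^+ 2 + b * F * (r ^+ 2 * g0) + (r ^+ 2 * g0) ^+ 2 - K) <= 0.
    by apply: le_trans h; rewrite le_eqVlt; apply/orP; left; apply/eqP; ring.
  rewrite pmulr_rle0 ?exprn_gt0 // => h'.
  have := sqr_ge0 (b * F + r ^+ 2 * g0).
  have aF : b ^+ 2 * F ^+ 2 <= a * F ^+ 2.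
    by rewrite ler_wpM2r ?sqr_ge0 // aE; have := sqr_ge0 b; lra.
  rewrite (_ : g0 ^+ 2 * r ^+ 4 = (r ^+ 2 * g0) ^+ 2); last by ring.
  rewrite -mulrA -/K; set X := r ^+ 2 * g0 in h' *.
  by nra.
apply: (max_principle (w := w) (sqdist_compact (c := c) (ltW r0))); last first.
  by rewrite /= sqdistxx sqr_ge0.
- move=> x /= Kx wx.
  have Qr : sqdist c x < r ^+ 2.
    rewrite lt_neqAle Kx andbT; apply/eqP => E; move: wx.
    by rewrite /w /P etaE E subrr !(mul0r, mulr0, addr0) ltxx.
  split; first exact: sqdist_nbhs.
  have [[p [l [fj lE]]] [q [m [gj mE]]] fS kS] := H x (inball _ Kx).
  pose e i := 2 * w0 i * (x 0 i - c 0 i); pose h : R := 2 * - r^-1.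
  have Jeta i : jet eta x (ev i) (e i) h.
    by apply: jet_eq (jetD (jet_cst r x (ev i)) (jet_quad w0 c x i)) _ _;
      rewrite add0r.
  have Jw i := jetD (jetD (jetD
     (jetZ a (jetM (jetM (Jeta i) (fj i)) (jetM (Jeta i) (fj i))))
     (jetZ b (jetM (jetM (jetM (Jeta i) (Jeta i)) (fj i))
                   (jetM (jetM (Jeta i) (Jeta i)) (gj i)))))
     (jetM (jetM (jetM (jetM (Jeta i) (Jeta i)) (Jeta i)) (gj i))
           (jetM (jetM (jetM (Jeta i) (Jeta i)) (Jeta i)) (gj i))))
     (jetZ K (jetD (jet_quad (fun=> 1) c x i) (jet_cst (- r ^+ 2) x (ev i)))).
  eexists; first by eexists; eexists; split; [exact: Jw|reflexivity].
  move=> /=.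
  set F := f x; set G0 := g x; set y := eta x.
  have y0 : 0 <= y by rewrite /y etaE divr_ge0 ?subr_ge0 // ltW.
  have yr : y <= r.
    by rewrite /y etaE ler_pdivrMr // -expr2 gerBl sqdist_ge0.
  pose X := y ^+ 2 * G0.
  pose lin i := 2 * a * y ^+ 2 * F * l i + b * y ^+ 4 * (G0 * l i + F * m i)
     + 2 * y ^+ 6 * G0 * m i + 2 * K.
  pose cc := y * h.
  have e4 i : e i ^+ 2 <= 4.
    rewrite /e /w0 (_ : _ ^+ 2 = 4 * ((x 0 i - c 0 i) ^+ 2 / r ^+ 2)); last first.
      by field.
    rewrite ler_piMr // ler_pdivrMr ?exprn_gt0 // mul1r.
    exact: le_trans (sqdist_coord c x i) Kx.
  have cc2 : -2 <= cc <= 0.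
    have yr1 : y / r <= 1 by rewrite ler_pdivrMr // mul1r.
    have yr0 : 0 <= y / r by rewrite divr_ge0 // ltW.
    by rewrite /cc /h; apply/andP; split; lra.
  apply: (@lt_le_trans _ _ (\sum_i (lin i
     + (- 590 * X ^+ 2 - (68 * a + 832 * b ^+ 2) * F ^+ 2)))); last first.
    apply: ler_sum => i _.
    have := interpolation_form F X (y * p i) (y ^+ 3 * q i) aE (e4 i) cc2.
    rewrite -(lerD2l (lin i)) => /le_trans; apply.
    by rewrite le_eqVlt; apply/orP; left; apply/eqP; rewrite /lin /X /cc; ring.
  (* the terms linear in second derivatives add up to Laplacians *)
  have linE : \sum_i lin i = 2 * a * y ^+ 2 * F * G0
     + b * y ^+ 4 * (G0 * G0 + F * k x) + 2 * y ^+ 6 * G0 * k x + 2 * K * n%:R.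
    rewrite /lin !big_split /= sumr_const card_ord -!mulr_sumr.
    by rewrite big_split /= -!mulr_sumr lE mE -[2 * K *+ n]mulr_natr.
  rewrite big_split /= linE sumr_const card_ord -[X in _ < _ + X]mulr_natr.
  have FS : F ^+ 2 <= S0 ^+ 2.
    by rewrite -[F ^+ 2]real_normK ?num_real // ler_sqr ?nnegrE // ltW.
  have kk : (y ^+ 4 * k x) ^+ 2 <= r ^+ 8 * S2 ^+ 2.
    rewrite exprMn -exprM; apply: ler_pM; rewrite ?sqr_ge0 ?exprn_ge0 //.
      by apply: lerXn2r; rewrite ?nnegrE // ltW.
    rewrite -[k x ^+ 2]real_normK ?num_real // lerXn2r ?nnegrE //.
    exact: le_trans kS.
  rewrite [ltRHS](_ : _ = 2 * a * F * X + b * X ^+ 2 + b * F * (y ^+ 4 * k x)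
     + 2 * X * (y ^+ 4 * k x) + 2 * K * n%:R - 590 * n%:R * X ^+ 2
     - n%:R * (68 * a + 832 * b ^+ 2) * F ^+ 2); last by rewrite /X; ring.
  set Z := y ^+ 4 * k x in kk *.
  have := sqr_ge0 (a * F + X); have := sqr_ge0 (b * F + Z).
  have := sqr_ge0 (X + Z).
  have nK : K <= K * n%:R by rewrite ler_peMr // ltW.
  have X2 : 2 * X ^+ 2 <= 2 * n%:R * X ^+ 2 by rewrite ler_wpM2r ?sqr_ge0 //; lra.
  have KF : C1 * F ^+ 2 + 2 * Z ^+ 2 <= K.
    have C1_ge0 : 0 <= C1 by apply: le_trans C10.
    rewrite /K mulrDr; apply: lerD; first exact: ler_wpM2l.
    by apply: ler_pM => //; exact: sqr_ge0.
  have bX : b * X ^+ 2 = 592 * n%:R * X ^+ 2 by rewrite bE.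
  have C1F : C1 * F ^+ 2 = n%:R * (68 * a + 832 * b ^+ 2) * F ^+ 2 +
    a ^+ 2 * F ^+ 2 + b ^+ 2 * F ^+ 2 + 2 * F ^+ 2 by rewrite C1E; ring.
  by have := sqr_ge0 F; have := sqr_ge0 Z; nra.
- move=> x /= /inball Kx; have [cf cg] := cH x Kx.
    pose Cc := @continuous_for_cst R V x.
  have cq : {for x, continuous (sqdist c)} by exact: quad_continuous.
  have e2 := continuous_forM (eta_cont x) (eta_cont x).
  have ef := continuous_forM (eta_cont x) cf.
  have eeeg := continuous_forM (continuous_forM e2 (eta_cont x)) cg.
  have eeef_eeeg := continuous_forM (continuous_forM e2 cf)
    (continuous_forM e2 cg).
  have aP := continuous_forM (Cc a) (continuous_forM ef ef).
  have abP := continuous_forD aP (continuous_forM (Cc b) eeef_eeeg).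
  have cP := continuous_forD abP (continuous_forM eeeg eeeg).
  exact: (continuous_forD cP
    (continuous_forM (Cc K) (continuous_forD cq (Cc (- r ^+ 2))))).
Qed.

End Interpolation.

(** * Interior bound for the Laplacian of a polyharmonic function *)

Section InteriorEstimate.
Variables (R : realType) (n : nat).
Local Notation V := 'rV[R]_n.
Implicit Types (f g k w : V -> R) (x c z : V).

(** A cube, because the norm of row vectors is the sup norm. *)
Definition cube c (r : R) := [set x : V | `|x - c| <= r].

Lemma polyharmonic_chain_sub N f G K :
  K `<=` G -> polyharmonic_chain N f G -> polyharmonic_chain N f K.
Proof.
move=> KG; elim: N f => [|N IH] f /= [fc].
  by move=> f0; split=> x /KG; [exact: fc|exact: f0].
move=> [g fg gN]; split; first by move=> x /KG; exact: fc.
by exists g; [move=> x /KG; exact: fg|exact: IH].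
Qed.

Lemma norm_continuous_for x c : {for x, continuous (fun z : V => `|z - c|)}.
Proof.
apply: (@continuous_comp _ _ _ (fun z : V => z - c) (fun z : V => `|z|)).
  by apply: continuousB; [exact: cvg_id|exact: cst_continuous].
exact: norm_continuous.
Qed.

Lemma cube_compact c r : compact (cube c r).
Proof.
apply: (subclosed_compact _ (box_compact (a := fun i => c 0 i - r)
                                      (b := fun i => c 0 i + r))).
  apply: (@closed_comp _ _ (fun z : V => `|z - c|) [set y : R | y <= r]).
    by move=> x _; exact: norm_continuous_for.
  exact: closed_le.
move=> x xr i.
have := le_trans (norm_coord (x - c) i) xr.
by rewrite !mxE ler_distlC => /andP[xl xu]; apply/andP; split; lra.
Qed.

Lemma interpolation_linear : (0 < n)%N -> exists2 C : R, 0 < C &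
  forall f g k c (r S0 S2 : R), 0 < r -> 0 < S0 -> 0 <= S2 ->
  (forall x, cube c r x -> {for x, continuous f} /\ {for x, continuous g}) ->
  (forall x, cube c r x -> [/\ laplace_at f x (g x), laplace_at g x (k x),
      `|f x| <= S0 & `|k x| <= S2]) ->
  `|g c| * r ^+ 2 <= C * (S0 + r ^+ 4 * S2).
Proof.
move=> /(interpolation R)[C C0 H]; exists (C + 1); first by rewrite addr_gt0.
move=> f g k c r S0 S2 r0 S00 S20 cH fgk.
have {fgk} h := H f g k c r S0 S2 r0 S00 cH fgk.
have r4 : 0 <= r ^+ 4 * S2 by rewrite mulr_ge0 // exprn_ge0 // ltW.
have A0 : 0 <= C + 1 by rewrite addr_ge0 // ltW.
suff : (`|g c| * r ^+ 2) ^+ 2 <= ((C + 1) * (S0 + r ^+ 4 * S2)) ^+ 2.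
  have h0 : 0 <= S0 + r ^+ 4 * S2 by rewrite addr_ge0 // ltW.
  by rewrite ler_sqr // nnegrE mulr_ge0 ?sqr_ge0.
rewrite exprMn real_normK ?num_real // -exprM (le_trans h) // exprMn.
apply: ler_pM; first exact: ltW.
- by rewrite addr_ge0 ?sqr_ge0 // mulr_ge0 ?sqr_ge0 // exprn_ge0 // ltW.
- by have := sqr_ge0 C; lra.
- have : 0 <= S0 * (r ^+ 4 * S2) by rewrite mulr_ge0 // ltW.
  by lra.
Qed.

(** Induction on the order [N] of [g].  Let [d] be the distance to the boundary
    of the cube and [x] a point where [d ^ 2 * |g|] is largest.  The bound for
    the Laplacian [k] of [g], of lower order, estimates [k] near [x] by this
    maximum divided by [d ^ 4].  Interpolation between [f] and [k] on a cube of
    radius [t * d] then bounds the maximum by a multiple of [S] plus itself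
    times a factor of order [t ^ 2], which is absorbed when [t] is small. *)
Lemma laplacian_interior_bound N : (0 < n)%N -> exists2 C : R, 0 < C &
  forall f g c (r S : R), 0 < r -> 0 < S ->
  (forall x, cube c r x ->
    [/\ {for x, continuous f}, laplace_at f x (g x) & `|f x| <= S]) ->
  polyharmonic_chain N g (cube c r) -> `|g c| * r ^+ 2 <= C * S.
Proof.
move=> n0; have [C1 C10 interp] := interpolation_linear n0.
elim: N => [|N [C C0 IH]].
  exists 1 => // f g c r S r0 S0 _ /= [_ g0].
  rewrite g0 ?normr0 ?mul0r ?mul1r ?ltW //.
  by rewrite /cube /= subrr normr0 ltW.
have CC : 0 < C * C1 by rewrite mulr_gt0.
(* [t] is the ratio, at the maximum point, of the radius of interpolation to
   the distance [d] *)
have [t [t0 t1 tC]] : exists t : R,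
    [/\ 0 < t, t <= 1 / 2 & 256 * C * C1 * t ^+ 2 <= 1 / 2].
  have M0 : 0 < 1 + C * C1 by rewrite addr_gt0.
  have [u [u0 uE]] : exists u : R, 0 < u /\ u * (1 + C * C1) = 1.
    by exists (1 + C * C1)^-1; rewrite invr_gt0 mulVf // gt_eqF.
  have uC : 0 < u * (C * C1) by rewrite mulr_gt0.
  have uuC : u * (u * (C * C1)) <= 1 * (u * (C * C1)).
    by rewrite ler_pM2r //; lra.
  by exists (u / 32); split; lra.
exists (2 * C1 / t ^+ 2); first by rewrite !(mulr_gt0, invr_gt0).
move=> f g c r S r0 S0 fP /= [gc [k gk kN]].
pose d x := r - `|x - c|.
pose psi x := `|g x| * (d x * d x).
have cB : cube c r c by rewrite /cube /= subrr normr0 ltW.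
have [x /[!inE] Bx xmax] : exists2 x, x \in cube c r &
    forall z, z \in cube c r -> psi z <= psi x.
  apply: compact_EVT_max; [by exists c|exact: cube_compact|].
  apply: continuous_in_subspaceT => z /[!inE] Bz.
  have dc : {for z, continuous d}.
    by apply: continuousB; [exact: cst_continuous|exact: norm_continuous_for].
  exact: continuous_forM (continuous_for_norm (gc _ Bz)) (continuous_forM dc dc).
have dx0 : 0 <= d x by rewrite subr_ge0.
have psic : psi c = `|g c| * r ^+ 2 by rewrite /psi /d subrr normr0 subr0 expr2.
rewrite -psic; apply: (@le_trans _ _ (psi x)).
  by apply: xmax; rewrite inE.
have RHS0 : 0 <= 2 * C1 / t ^+ 2 * S.
  by rewrite !(mulr_ge0, invr_ge0) // ?exprn_ge0 // ltW.
have [psi0|psi_gt0] := leP (psi x) 0; first exact: le_trans RHS0.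
have {dx0} dx0 : 0 < d x.
  rewrite lt_neqAle dx0 andbT; apply/eqP => d0; move: psi_gt0.
  by rewrite /psi -d0 !mulr0 ltxx.
set D := d x in dx0 *.
have dB z s : `|z - x| <= s -> D - s <= d z.
  move=> zs; rewrite /D /d; have := ler_normD (z - x) (x - c).
  by rewrite addrA subrK => ?; lra.
have gB z : D / 4 <= d z -> `|g z| <= 16 * psi x / D ^+ 2.
  move=> zD; have dz0 : 0 < d z by apply: lt_le_trans zD; rewrite divr_gt0.
  have Bz : cube c r z by rewrite /cube /= -subr_ge0 ltW.
  rewrite ler_pdivlMr ?exprn_gt0 //.
  have := xmax z; rewrite inE => /(_ Bz); rewrite {1}/psi.
  have : (D / 4) * (D / 4) <= d z * d z.
    by apply: ler_pM => //; rewrite divr_ge0 // ltW.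
  move=> /(ler_wpM2l (normr_ge0 (g z))) h1 h2.
  by have := le_trans h1 h2; rewrite expr2; lra.
pose S2 := C * (16 * psi x / D ^+ 2) / (D / 4) ^+ 2.
have P0 : 0 < 16 * psi x / D ^+ 2 by rewrite divr_gt0 ?exprn_gt0 // mulr_gt0.
have S20 : 0 <= S2.
  by rewrite divr_ge0 ?sqr_ge0 // mulr_ge0 // ltW.
have sub z s : `|z - x| <= s -> s <= D -> cube c r z.
  by move=> /dB zs sD; rewrite /cube /= -subr_ge0 (le_trans _ zs) // subr_ge0.
have tD : t * D <= D / 2 by rewrite mulrC ler_pM2l //; lra.
have tD0 : 0 < t * D by rewrite mulr_gt0.
have DD : D / 2 <= D by lra.
(* on the cube of radius [t * D] the distance [d] is at least [D / 2], and
   the induction hypothesis is used there with the radius [D / 4] *)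
have h : `|g x| * (t * D) ^+ 2 <= C1 * (S + (t * D) ^+ 4 * S2).
  apply: (interp f g k) => // z Bz.
    have {}Bz : cube c r z by apply: sub Bz _; lra.
    by have [fc _ _] := fP _ Bz; split=> //; exact: gc.
  have Bcz : cube c r z by apply: sub Bz _; lra.
  have [_ fl fS] := fP _ Bcz; split=> //; first exact: gk.
  rewrite /S2 ler_pdivlMr; last by rewrite exprn_gt0 // divr_gt0.
  have zD : D / 2 <= d z by apply: le_trans (dB _ _ Bz); lra.
  have D40 : 0 < D / 4 by rewrite divr_gt0.
  have sub4 y : cube z (D / 4) y -> cube c r y /\ D / 4 <= d y.
    move=> yz; have : d z - D / 4 <= d y.
      rewrite /d; have := ler_normD (y - z) (z - c).
      by move: yz; rewrite /cube /= addrA subrK => *; lra.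
    by move=> dy; split; [rewrite /cube /= -subr_ge0 -/(d y)|]; lra.
  apply: (IH g k) => // [y /sub4[By yD]|].
    by split; [exact: gc|exact: gk|exact: gB].
  by apply: polyharmonic_chain_sub kN => y /sub4[].
have PE : psi x = `|g x| * (D * D) by [].
have E1 : `|g x| * (t * D) ^+ 2 = psi x * t ^+ 2 by rewrite PE; ring.
have E2 : (t * D) ^+ 4 * S2 = 256 * C * t ^+ 4 * psi x.
  by rewrite /S2; field; rewrite gt_eqF.
move: h; rewrite E1 E2 => h.
have : 256 * C * C1 * t ^+ 2 * (psi x * t ^+ 2) <= 1 / 2 * (psi x * t ^+ 2).
  by rewrite ler_wpM2r // mulr_ge0 ?sqr_ge0 // ltW.
move=> h3; rewrite [leRHS]mulrAC ler_pdivlMr ?exprn_gt0 //.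
move: h h3; set A := psi x * t ^+ 2.
have -> : 256 * C * C1 * t ^+ 2 * A = 256 * C * t ^+ 4 * psi x * C1.
  by rewrite /A; ring.
by lra.
Qed.

End InteriorEstimate.

(** * Harmonic functions vanishing on a hyperplane *)

Section Boundary.
Variables (R : realType) (n : nat) (i0 : 'I_n).
Local Notation V := 'rV[R]_n.
Local Notation ev := (@basis_vector R n).
Implicit Types (f g k v w : V -> R) (x c z : V).

Definition half_cylinder c (r : R) : set V :=
  box (fun i => if i == i0 then 0 else c 0 i - r)
      (fun i => if i == i0 then r else c 0 i + r).

Lemma half_cylinderP c r x : half_cylinder c r x <->
  0 <= x 0 i0 <= r /\ forall i, i != i0 -> `|x 0 i - c 0 i| <= r.
Proof.
split=> [H|[H1 H2] i /=].
  split; first by have := H i0; rewrite eqxx.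
  by move=> i /negPf ii0; have := H i; rewrite ii0 ler_distlC => /andP[? ?]; lra.
case: eqP => [-> //|/eqP/H2]; rewrite ler_distlC => /andP[? ?].
by apply/andP; split; lra.
Qed.

(** Write t for the coordinate [i0] and y for the other ones.  The barrier
      S (|y - c| ^ 2 / r ^ 2 + (n + 1) t / r - n t ^ 2 / r ^ 2)
    has the Laplacian - 2 S / r ^ 2, is nonnegative on the face t = 0, and is at
    least [S] on the other faces of the cylinder. *)
Lemma barrier_upper v c (r S : R) : 0 < r -> 0 < S -> c 0 i0 = 0 ->
  (forall x, half_cylinder c r x -> [/\ {for x, continuous v},
     (0 < x 0 i0 -> laplace_at v x 0), (x 0 i0 = 0 -> v x = 0) & v x <= S]) ->
  forall x, half_cylinder c r x -> (forall i, i != i0 -> x 0 i = c 0 i) ->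
  v x <= n.+1%:R * S * (x 0 i0 / r).
Proof.
move=> r0 S0 ci0 H x Bx xc.
have n1 : 1 <= n%:R :> R by rewrite ler1n (leq_ltn_trans _ (ltn_ord i0)).
have rn0 : r != 0 by rewrite gt_eqF.
pose W i : R := if i == i0 then - (n%:R * (S / r ^+ 2)) else S / r ^+ 2.
pose b z := quad W c z + (n.+1%:R * S / r) * z 0 i0.
pose w z := v z + - b z.
have bE z : b z = S * ((\sum_(i | i != i0) ((z 0 i - c 0 i) / r) ^+ 2)
     + (z 0 i0 / r) * (n.+1%:R - n%:R * (z 0 i0 / r))).
  rewrite /b /quad (bigD1 i0) //= /W eqxx ci0 subr0.
  rewrite (eq_bigr (fun i => S * ((z 0 i - c 0 i) / r) ^+ 2)); last first.
    by move=> i /negPf ->; field.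
  by rewrite -mulr_sumr; field.
suff : w x <= 0.
  rewrite /w subr_le0 => /le_trans; apply; rewrite bE big1 => [|i /xc ->].
    have [/andP[x0 _] _] := (half_cylinderP c r x).1 Bx.
    have s0 : 0 <= x 0 i0 / r by rewrite divr_ge0 // ltW.
    have : 0 <= S * (n%:R * (x 0 i0 / r * (x 0 i0 / r))).
      by apply: mulr_ge0 (ltW S0) (mulr_ge0 (ler0n _ _) (mulr_ge0 s0 s0)).
    by rewrite -natr1; lra.
  by rewrite subrr mul0r expr0n.
have Kc : compact (half_cylinder c r) by exact: box_compact.
apply: (max_principle (w := w) Kc) => // z Bz.
  have [vz _ _ _] := H z Bz.
  apply: continuous_forD => //; apply: continuous_forN.
  apply: continuous_forD; first exact: quad_continuous.
  apply: continuous_forM; first exact: continuous_for_cst.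
  exact: coord_continuous.
move=> wz; have [vz lv v0 vS] := H z Bz.
have [/andP[z0 zr] zc] := (half_cylinderP c r z).1 Bz.
have sum0 : 0 <= \sum_(i | i != i0) ((z 0 i - c 0 i) / r) ^+ 2.
  by apply: sumr_ge0 => i _; exact: sqr_ge0.
set s := z 0 i0 / r in bE.
have s0 : 0 <= s by rewrite divr_ge0 // ltW.
have s1 : s <= 1 by rewrite ler_pdivrMr // mul1r.
have nn : n.+1%:R = n%:R + 1 :> R by rewrite -natr1.
have poly0 : 0 <= s * (n.+1%:R - n%:R * s).
  rewrite mulr_ge0 // subr_ge0 nn.
  have : n%:R * s <= n%:R * 1 by rewrite ler_wpM2l.
  by lra.
have bS : b z < S.
  by rewrite (lt_le_trans _ vS) // -subr_gt0.
have bS1 : \sum_(i | i != i0) ((z 0 i - c 0 i) / r) ^+ 2 +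
    s * (n.+1%:R - n%:R * s) < 1.
  by move: bS; rewrite bE -[ltRHS]mulr1 ltr_pM2l.
have zpos : 0 < z 0 i0.
  rewrite lt_neqAle z0 andbT; apply/eqP => z00.
  move: wz; rewrite /w v0 // sub0r oppr_gt0 bE ltNge mulr_ge0 ?(ltW S0) //.
  exact: addr_ge0.
split.
  apply: box_nbhs => i; case: eqP => [->|/eqP ii0].
    rewrite zpos /= lt_neqAle zr andbT; apply/eqP => zr'.
    move: bS1; rewrite /s zr' divff // nn; lra.
  have := zc i ii0; rewrite le_eqVlt => /predU1P[zr'|].
    move: bS1; rewrite (bigD1 i) //=.
    have -> : ((z 0 i - c 0 i) / r) ^+ 2 = 1.
      by rewrite -[LHS]real_normK ?num_real // normrM zr' normfV gtr0_norm //
         divff // expr1n.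
    have : 0 <= \sum_(j | (j != i0) && (j != i)) ((z 0 j - c 0 j) / r) ^+ 2.
      by apply: sumr_ge0 => j _; exact: sqr_ge0.
    by lra.
  by rewrite ltr_distlC => /andP[? ?]; apply/andP; split; lra.
exists (0 + - (2 * - (S / r ^+ 2) + 0)).
  apply: laplace_atD; first exact: lv.
  apply: laplace_atN.
  exists (fun i => 2 * W i * (z 0 i - c 0 i) + n.+1%:R * S / r * (i0 == i)%:R),
    (fun i => 2 * W i + n.+1%:R * S / r * 0); split.
    by move=> i; apply: jetD (jet_quad _ _ _ _) (jetZ _ (jet_coord _ _ _)).
  rewrite big_split /= -!mulr_sumr; congr (2 * _ + _); last first.
    by rewrite big1 // mulr0.
  rewrite (bigD1 i0) //= /W eqxx (eq_bigr (fun=> S / r ^+ 2)); last first.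
    by move=> i /negPf ->.
  rewrite sumr_const (cardC1 i0) card_ord -mulr_natl.
  have -> : n%:R = n.-1%:R + 1 :> R.
    by rewrite natr1 prednK // (leq_ltn_trans _ (ltn_ord i0)).
  by ring.
have : 0 < S / r ^+ 2 by rewrite divr_gt0 // exprn_gt0.
by lra.
Qed.

End Boundary.

Section BoundaryDecay.
Variables (R : realType) (n : nat) (i0 : 'I_n).
Local Notation V := 'rV[R]_n.
Implicit Types (f g k v w : V -> R) (x c z : V).

Lemma barrier v c (r S : R) : 0 < r -> 0 < S -> c 0 i0 = 0 ->
  (forall x, half_cylinder i0 c r x -> [/\ {for x, continuous v},
     (0 < x 0 i0 -> laplace_at v x 0), (x 0 i0 = 0 -> v x = 0) & `|v x| <= S]) ->
  forall x, half_cylinder i0 c r x -> (forall i, i != i0 -> x 0 i = c 0 i) ->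
  `|v x| <= n.+1%:R * S * (x 0 i0 / r).
Proof.
move=> r0 S0 ci0 H x Bx xc; rewrite ler_norml lerNl; apply/andP; split.
  apply: (barrier_upper (v := fun z => - v z) r0 S0 ci0 _ Bx xc) => z Bz.
  have [vz lv v0 vS] := H z Bz; split.
  - exact: continuous_forN.
  - by move=> /lv/laplace_atN; rewrite oppr0.
  - by move=> /v0 ->; rewrite oppr0.
  - by rewrite (le_trans (ler_norm _)) // normrN.
apply: (barrier_upper (v := v) r0 S0 ci0 _ Bx xc) => z Bz.
have [vz lv v0 vS] := H z Bz; split=> //.
exact: le_trans (ler_norm _) vS.
Qed.

(** A singularity of order [q] at the hyperplane is impossible for a harmonic
    function that vanishes there.  At a point [x] where [|v| * d ^ q.+1] is
    largest, [d] being the distance to the boundary of the unit cube, either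
    [x] is at distance at least [t * d] from the hyperplane and the assumed
    bound applies, or the barrier on a cylinder of size [d x / 2] shows that the
    maximum is at most half of itself.  One more use of the barrier turns the
    resulting bound for [v] into linear decay. *)
Lemma boundary_decay (q : nat) : exists2 C : R, 0 < C &
  forall v c (M : R), 0 < M -> c 0 i0 = 0 ->
  (forall x, cube c 1 x -> 0 <= x 0 i0 -> [/\ {for x, continuous v},
     (0 < x 0 i0 -> laplace_at v x 0), (x 0 i0 = 0 -> v x = 0)
     & `|v x| * x 0 i0 ^+ q <= M]) ->
  forall x, 0 <= x 0 i0 <= 1 / 2 -> (forall i, i != i0 -> x 0 i = c 0 i) ->
  `|v x| <= C * M * x 0 i0.
Proof.
have [N [NE N1]] : exists N : R, N = n.+1%:R /\ 1 <= N.
  by exists n.+1%:R; rewrite ler1n.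
have N0 : 0 < N by apply: lt_le_trans N1.
have [B [BE B1]] : exists B : R, B = 2 ^+ q.+1 /\ 1 <= B.
  by exists (2 ^+ q.+1); rewrite exprn_ege1 // ler1n.
have B0 : 0 < B by apply: lt_le_trans B1.
(* the ratio below which the barrier reproduces half of the maximum *)
have [t [t0 tE]] : exists t : R, 0 < t /\ 2 * N * B * t = 1 / 2.
  exists (4 * N * B)^-1; split; first by rewrite invr_gt0 !mulr_gt0.
  by field; rewrite !gt_eqF.
exists (2 * N * B / t ^+ q).
  by rewrite divr_gt0 ?exprn_gt0 // !mulr_gt0.
move=> v c M M0 ci0 H.
pose d (x : V) : R := 1 - `|x - c|.
pose K := cube c 1 `&` [set x : V | 0 <= x 0 i0].
pose psi (x : V) : R := `|v x| * d x ^+ q.+1.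
have d_cont x : {for x, continuous d}.
  apply: continuous_forD; first exact: continuous_for_cst.
  by apply: continuous_forN; exact: norm_continuous_for.
have Kc : compact K.
  apply: compact_closedI; first exact: cube_compact.
  apply: (@closed_comp _ _ (fun z : V => z 0 i0) [set y : R | 0 <= y]).
    by move=> x _; exact: coord_continuous.
  exact: closed_ge.
have cK : K c by split; rewrite /cube /= ?subrr ?normr0 // ci0.
have [x /[!inE] Kx xmax] : exists2 x, x \in K &
    forall z, z \in K -> psi z <= psi x.
  apply: compact_EVT_max; [by exists c|exact: Kc|].
  apply: continuous_in_subspaceT => z /[!inE] -[Bz z0].
  have [vz _ _ _] := H z Bz z0.
  have dX : {for z, continuous (fun y => d y ^+ q.+1)}.
    exact: continuous_forX (d_cont z).
  have vN := continuous_for_norm vz.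
  exact: (continuous_forM vN dX).
have {}xmax z : K z -> psi z <= psi x by move=> Kz; apply: xmax; rewrite inE.
(* one application of the barrier, based at a point [b] of the hyperplane *)
have step (P : R) (b : V) (s : R) (y : V) :
    0 < P -> (forall z, K z -> psi z <= P) ->
    0 < s -> b 0 i0 = 0 -> `|b - c| <= 1 - 2 * s ->
    0 <= y 0 i0 <= s -> (forall i, i != i0 -> y 0 i = b 0 i) ->
    `|v y| <= N * (P / s ^+ q.+1) * (y 0 i0 / s).
  move=> P0 psiP s0 b0 bc ys yb; rewrite NE.
  apply: (barrier (c := b)) => //.
  - by rewrite divr_gt0 // exprn_gt0.
  - move=> z /half_cylinderP[/andP[z0 zs] zb].
    have s12 := le_trans (normr_ge0 _) bc.
    have sd : s <= d z.
      rewrite /d lerBrDr -lerBrDl; apply: norm_le_coord; first by lra.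
      move=> i; rewrite !mxE; have [->|ii0] := eqVneq i i0.
        by rewrite ci0 subr0 ger0_norm //; lra.
      have := zb _ ii0; have := le_trans (norm_coord (b - c) i) bc; rewrite !mxE.
      have := ler_normD (z 0 i - b 0 i) (b 0 i - c 0 i).
      by rewrite addrA subrK; lra.
    have Kz : K z.
      by split=> //; rewrite /cube /= -subr_ge0; apply: le_trans sd; exact: ltW.
    have [vz lv v0 _] := H z Kz.1 Kz.2.
    split=> //; rewrite ler_pdivlMr ?exprn_gt0 //.
    apply: le_trans (psiP z Kz); rewrite ler_wpM2l //.
    by rewrite lerXn2r ?nnegrE // ltW // (lt_le_trans s0).
  - apply/half_cylinderP; split=> // i /yb ->.
    by rewrite subrr normr0 ltW.
have psiM : psi x <= M / t ^+ q.
  have MT : 0 <= M / t ^+ q by rewrite divr_ge0 // ?exprn_ge0 // ltW.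
  have [psi0|psi0] := leP (psi x) 0; first exact: le_trans MT.
  case: Kx => Bx x0.
  have dx0 : 0 < d x.
    have : 0 <= d x by rewrite subr_ge0.
    rewrite le_eqVlt => /predU1P[d0|//]; move: psi0.
    by rewrite /psi -d0 expr0n mulr0 ltxx.
  have dx1 : d x <= 1 by rewrite gerBl.
  have [tx|xt] := leP (t * d x) (x 0 i0).
    have [_ _ _ vM] := H x Bx x0.
    rewrite ler_pdivlMr ?exprn_gt0 //; apply: le_trans vM.
    rewrite /psi -mulrA ler_wpM2l // exprS -mulrA -exprMn.
    have h : (d x * t) ^+ q <= x 0 i0 ^+ q.
      by rewrite mulrC; apply: lerXn2r => //; rewrite nnegrE // mulr_ge0 // ltW.
    apply: le_trans h; apply: ler_piMl => //.
    by rewrite exprn_ge0 // mulr_ge0 // ltW.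
  have t1 : t <= 1 / 2.
    rewrite -tE ler_peMl ?(ltW t0) //.
    have : 1 * 1 <= N * B by apply: ler_pM.
    by lra.
  pose b : V := \row_i if i == i0 then 0 else x 0 i.
  have b0 : b 0 i0 = 0 by rewrite mxE eqxx.
  have bc : `|b - c| <= 1 - d x.
    apply: norm_le_coord; first by lra.
    move=> i; rewrite !mxE; case: eqP => [->|_].
      by rewrite ci0 subrr normr0; lra.
    by have := norm_coord (x - c) i; rewrite !mxE /d; lra.
  have xd : x 0 i0 <= d x / 2.
    have : t * d x <= 1 / 2 * d x by rewrite ler_pM2r.
    by lra.
    have h : `|v x| <= N * (psi x / (d x / 2) ^+ q.+1) * (x 0 i0 / (d x / 2)).
    have d2 : 0 < d x / 2 by rewrite divr_gt0.
    have bc2 : `|b - c| <= 1 - 2 * (d x / 2) by lra.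
    have x0d : 0 <= x 0 i0 <= d x / 2 by apply/andP; split.
    apply: (step _ b) => //.
    by move=> i /negPf ii0; rewrite mxE ii0.
  have E : N * (psi x / (d x / 2) ^+ q.+1) * (x 0 i0 / (d x / 2)) * d x ^+ q.+1
     = 2 * N * B * (x 0 i0 / d x) * psi x.
    rewrite expr_div_n -BE; field.
    by rewrite expf_neq0 ?gt_eqF.
  have psi1 : psi x <= 2 * N * B * (x 0 i0 / d x) * psi x.
    by rewrite -E ler_wpM2r // exprn_ge0 // ltW.
  have xdt : x 0 i0 / d x <= t by rewrite ler_pdivrMr // ltW.
  have : 2 * N * B * (x 0 i0 / d x) * psi x <= 1 / 2 * psi x.
    by rewrite ler_pM2r // -tE ler_pM2l // !mulr_gt0.
  by lra.
move=> y y0 yc.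
have P0 : 0 < M / t ^+ q by rewrite divr_gt0 // exprn_gt0.
have psiP z : K z -> psi z <= M / t ^+ q.
  by move=> /xmax zx; exact: le_trans psiM.
have cc : `|c - c| <= 1 - 2 * (1 / 2) by rewrite subrr normr0; lra.
have half0 : 0 < 1 / 2 :> R by rewrite divr_gt0.
apply: le_trans (step _ c (1 / 2) y P0 psiP half0 ci0 cc y0 yc) _.
rewrite expr_div_n expr1n -BE le_eqVlt; apply/orP; left; apply/eqP; field.
by rewrite expf_neq0 ?gt_eqF.
Qed.

End BoundaryDecay.

(** * A radial supersolution with the critical growth *)

Section Weight.
Variables (R : realType) (n : nat) (i0 : 'I_n).
Local Notation V := 'rV[R]_n.
Local Notation ev := (@basis_vector R n).
Implicit Types (f g k v w : V -> R) (x c z : V).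

Definition axis_sq x : R := quad (fun i => (i != i0)%:R) 0 x.

Lemma axis_sqE x : axis_sq x = \sum_(i | i != i0) x 0 i ^+ 2.
Proof.
rewrite /axis_sq /quad [RHS]big_mkcond /=; apply: eq_bigr => i _.
by rewrite mxE subr0; case: (i != i0); rewrite ?mul1r ?mul0r.
Qed.

Lemma axis_sq_ge0 x : 0 <= axis_sq x.
Proof. by rewrite axis_sqE sumr_ge0 // => i _; exact: sqr_ge0. Qed.

Lemma axis_sq_coord x i : i != i0 -> x 0 i ^+ 2 <= axis_sq x.
Proof.
move=> ii0; rewrite axis_sqE (bigD1 i) //= lerDl.
by apply: sumr_ge0 => j _; exact: sqr_ge0.
Qed.

(** The constant added under the root makes [weight_supersolution] hold also at
    bounded distance from the axis. *)
Definition axis_bracket x : R := Num.sqrt (n%:R ^+ 2 + axis_sq x).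

Local Notation sb := axis_bracket.

Let n1 : 1 <= n%:R :> R.
Proof. by rewrite ler1n (leq_ltn_trans _ (ltn_ord i0)). Qed.

Lemma axis_bracket_sq x : sb x ^+ 2 = n%:R ^+ 2 + axis_sq x.
Proof. by rewrite sqr_sqrtr // addr_ge0 ?sqr_ge0 ?axis_sq_ge0. Qed.

Lemma axis_bracket_ge x : n%:R <= sb x.
Proof.
by rewrite -(@ler_sqr R) ?nnegrE ?sqrtr_ge0 // axis_bracket_sq lerDl axis_sq_ge0.
Qed.

Lemma axis_bracket_gt0 x : 0 < sb x.
Proof. by apply: lt_le_trans (axis_bracket_ge x); rewrite (lt_le_trans _ n1). Qed.

Lemma is_derive_inv_sqrt (z : R) : 0 < z ->
  is_derive z 1 (fun y : R => (2 * Num.sqrt y)^-1) (- (4 * z * Num.sqrt z)^-1).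
Proof.
move=> z0; have sz : 0 < Num.sqrt z by rewrite sqrtr_gt0.
have dz : is_derive z 1 (fun y : R => 2 * Num.sqrt y) (2 * (2 * Num.sqrt z)^-1).
  exact: is_deriveZ (is_derive1_sqrt z0).
have nz : 2 * Num.sqrt z != 0 by rewrite gt_eqF // mulr_gt0.
apply: is_derive_eq (@is_deriveV R (fun y : R => 2 * Num.sqrt y) z _ _ nz dz) _.
have zE : z = Num.sqrt z ^+ 2 by rewrite sqr_sqrtr // ltW.
move: sz zE {dz nz}; rewrite /GRing.scale /=.
move: (Num.sqrt z) => r r0 ->; field.
by rewrite gt_eqF.
Qed.

Lemma jet_bracket x i : jet sb x (ev i) ((i != i0)%:R * x 0 i / sb x)
  ((i != i0)%:R * (1 / sb x - x 0 i ^+ 2 / sb x ^+ 3)).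
Proof.
have j1 : jet (fun z => n%:R ^+ 2 + axis_sq z) x (ev i)
   (0 + 2 * (i != i0)%:R * (x 0 i - (0 : V) 0 i)) (0 + 2 * (i != i0)%:R).
  exact: jetD (jet_cst _ _ _) (jet_quad _ _ _ _).
have pos z : 0 < n%:R ^+ 2 + axis_sq z.
  by rewrite ltr_pwDl ?axis_sq_ge0 // exprn_gt0 // (lt_le_trans _ n1).
have := jet_comp_total j1 (G := @Num.sqrt R)
  (G' := fun y => (2 * Num.sqrt y)^-1) (fun z => is_derive1_sqrt (pos z))
  (is_derive_inv_sqrt (pos x)).
move=> j2; apply: jet_eq j2 _ _; rewrite -/(sb x) mxE.
  by field; rewrite gt_eqF // axis_bracket_gt0.
rewrite -axis_bracket_sq; case: (i != i0) => /=; last first.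
  by rewrite !(mulr0n, mul0r, mulr0, expr0n, addr0).
by field; rewrite gt_eqF // axis_bracket_gt0.
Qed.

(** This is (d - 1) / 2 for [n = 1 + d]. *)
Definition decay_exponent : R := (n%:R - 2) / 2.
Local Notation a := decay_exponent.

Definition weight x : R := expR (sb x - a * ln (sb x)).

Lemma weight_gt0 x : 0 < weight x.
Proof. exact: expR_gt0. Qed.

Lemma jet_weight x : exists p q : 'I_n -> R,
  [/\ forall i, jet weight x (ev i) (p i) (q i), p i0 = 0 &
      \sum_i q i = weight x * (((1 - a / sb x) ^+ 2 + a / sb x ^+ 2)
         * (axis_sq x / sb x ^+ 2)
         + (1 - a / sb x) * ((n%:R - 1) / sb x - axis_sq x / sb x ^+ 3))].
Proof.
set s := sb x; have s0 : 0 < s := axis_bracket_gt0 x.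
have sn0 : s != 0 by rewrite gt_eqF.
pose ps i : R := (i != i0)%:R * x 0 i / s.
pose qs i : R := (i != i0)%:R * (1 / s - x 0 i ^+ 2 / s ^+ 3).
pose th (y : R) := y - a * ln y; pose th' (y : R) := 1 - a / y.
have dth (y : R) : 0 < y -> is_derive y 1 th (th' y).
  by move=> y0; apply: is_deriveB; apply: is_deriveZ; exact: is_derive1_ln.
have dth' : is_derive s 1 th' (a / s ^+ 2).
  have -> : a / s ^+ 2 = 0 - a * (- s ^- 2 * 1) by field.
  apply: is_deriveB; apply: is_deriveZ; exact: is_deriveV.
have j1 i : jet (th \o sb) x (ev i) (th' s * ps i)
    (a / s ^+ 2 * ps i ^+ 2 + th' s * qs i).
  exact: (@jet_comp_total _ _ th th' _ _ _ _ _ _ (jet_bracket x i)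
    (fun z => dth _ (axis_bracket_gt0 z)) dth').
have j2 i : jet weight x (ev i) (weight x * (th' s * ps i))
   (weight x * (th' s * ps i) ^+ 2
    + weight x * (a / s ^+ 2 * ps i ^+ 2 + th' s * qs i)).
  exact: (@jet_comp_total _ _ expR expR _ _ _ _ _ _ (j1 i)
    (fun z => is_derive_expR _) (is_derive_expR _)).
do 2!eexists; split; [exact: j2|by rewrite /ps eqxx !mul0r !mulr0|].
rewrite (eq_bigr (fun i => weight x * ((th' s ^+ 2 + a / s ^+ 2) * ps i ^+ 2
  + th' s * qs i))); last by move=> i _; ring.
rewrite -mulr_sumr; congr (_ * _).
rewrite big_split /= -!mulr_sumr; congr (_ * _ + _ * _).
  rewrite axis_sqE mulr_suml [RHS]big_mkcond /=; apply: eq_bigr => i _.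
  rewrite /ps; case: (i != i0) => /=; first by rewrite mul1r expr_div_n.
  by rewrite !mul0r expr0n.
rewrite /qs axis_sqE mulr_suml.
have -> : (n%:R - 1) / s = \sum_(i | i != i0) s^-1.
  rewrite sumr_const (cardC1 i0) card_ord -[RHS]mulr_natl.
  have -> : n%:R = n.-1%:R + 1 :> R.
    by rewrite natr1 prednK // (leq_ltn_trans _ (ltn_ord i0)).
  by rewrite addrK.
rewrite -sumrB [RHS]big_mkcond /=; apply: eq_bigr => i _.
by case: (i != i0) => /=; [rewrite !mul1r|rewrite mul0r].
Qed.

(** Let s be the bracket and a the exponent.  The quotient lap U / U is
    1 + c(s) / s ^ 2: the terms of order 1 / s cancel by the choice of a, and
    c(s) is negative because of the constant n ^ 2 in s ^ 2. *)
Lemma weight_supersolution : (1 < n)%N -> forall x, exists p q : 'I_n -> R,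
  [/\ forall i, jet weight x (ev i) (p i) (q i), p i0 = 0 &
      \sum_i q i < weight x].
Proof.
move=> n2 x; have [p [q [jw p0 qE]]] := jet_weight x; exists p, q; split=> //.
rewrite qE gtr_pMr ?weight_gt0 //.
have sn := axis_bracket_ge x; have s0 := axis_bracket_gt0 x.
have -> : axis_sq x = sb x ^+ 2 - n%:R ^+ 2.
  by rewrite axis_bracket_sq addrAC subrr add0r.
have nE : n%:R = 2 * a + 2 by rewrite /a; field.
have a0 : 0 <= a by rewrite divr_ge0 // subr_ge0 ler_nat.
move: sn s0; rewrite nE; move: (sb x) a a0 => s b b0 sn s0.
rewrite -subr_gt0.
rewrite (_ : _ - _ = s ^- 2 * ((2 * b + 2) ^+ 2 - b + b ^+ 2
   - (2 * b + 1) * (2 * b + 2) * ((2 * b + 2) / s)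
   + (b ^+ 2 + 2 * b) * ((2 * b + 2) / s) ^+ 2)); last first.
  by field; rewrite gt_eqF.
rewrite mulr_gt0 ?invr_gt0 ?exprn_gt0 //.
have t1 : (2 * b + 2) / s <= 1 by rewrite ler_pdivrMr // mul1r.
have t0 : 0 <= (2 * b + 2) / s by rewrite divr_ge0 ?ltW //; lra.
move: ((2 * b + 2) / s) t0 t1 => t t0 t1.
have h1 : (2 * b + 1) * (2 * b + 2) * t <= (2 * b + 1) * (2 * b + 2) * 1.
  by rewrite ler_wpM2l // mulr_ge0 //; lra.
have h2 : 0 <= (b ^+ 2 + 2 * b) * t ^+ 2.
  by rewrite mulr_ge0 ?sqr_ge0 // addr_ge0 ?sqr_ge0 // mulr_ge0.
by have := sqr_ge0 b; lra.
Qed.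

Lemma axis_bracket_near x z : (forall i, `|z 0 i - x 0 i| <= 1) ->
  sb z <= sb x + n%:R.
Proof.
move=> zx; have sn := axis_bracket_ge x; have s0 := axis_bracket_gt0 x.
rewrite -(@ler_sqr R) ?nnegrE ?sqrtr_ge0 ?addr_ge0 ?sqrtr_ge0 //.
rewrite axis_bracket_sq sqrrD axis_bracket_sq.
have : axis_sq z <= axis_sq x + \sum_(i < n) (2 * sb x + 1).
  rewrite !axis_sqE big_mkcond [in leRHS]big_mkcond -big_split /=.
  apply: ler_sum => i _; case: ifP => ii0; last by lra.
  have xi : `|x 0 i| <= sb x.
    rewrite -(@ler_sqr R) ?nnegrE ?sqrtr_ge0 // real_normK ?num_real //.
    by rewrite axis_bracket_sq (le_trans (axis_sq_coord x ii0)) // lerDr sqr_ge0.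
  have := zx i; move: xi; rewrite !ler_norml => /andP[? ?] /andP[? ?].
  have : (z 0 i - x 0 i) * (z 0 i - x 0 i) <= 1 by nra.
  have : x 0 i * (z 0 i - x 0 i) <= sb x * 1 by nra.
  by lra.
rewrite sumr_const card_ord -mulr_natr => h.
have : n%:R * 1 <= n%:R * n%:R :> R by rewrite ler_wpM2l.
by lra.
Qed.

(** Lets suprema over unit cubes be replaced by values at the centre. *)
Lemma weight_harnack : (1 < n)%N -> exists2 C : R, 0 < C &
  forall x z, (forall i, `|z 0 i - x 0 i| <= 1) -> weight z <= C * weight x.
Proof.
move=> n2; exists (expR (n%:R + a * ln 2)); first exact: expR_gt0.
move=> x z zx; rewrite -expRD ler_expR.
have a0 : 0 <= a by rewrite divr_ge0 // subr_ge0 ler_nat.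
have h1 := axis_bracket_near zx.
have : sb x <= sb z + n%:R.
  by apply: axis_bracket_near => i; rewrite distrC.
have z0 := axis_bracket_gt0 z; have zn := axis_bracket_ge z => h2.
have : ln (sb x) <= ln (2 * sb z).
  by rewrite ler_ln ?posrE ?axis_bracket_gt0 ?mulr_gt0 //; lra.
rewrite lnM ?posrE // => /(ler_wpM2l a0).
by lra.
Qed.

(** The growth rate of the theorem, written with [r] the distance to the axis. *)
Lemma growth_le_weight : (1 < n)%N -> exists2 C : R, 0 < C &
  forall x (r : R), 0 <= r -> r ^+ 2 = axis_sq x -> n%:R <= r ->
  r `^ (- a) * expR r <= C * weight x.
Proof.
move=> n2; exists (expR (a * ln 2)); first exact: expR_gt0.
move=> x r r0 rE nr.
have rpos : 0 < r by apply: lt_le_trans nr; rewrite (lt_le_trans _ n1).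
have a0 : 0 <= a by rewrite divr_ge0 // subr_ge0 ler_nat.
rewrite /powR gt_eqF // -!expRD ler_expR.
have s2 := axis_bracket_sq x; have s0 := axis_bracket_gt0 x.
have rs : r <= sb x.
  by rewrite -(@ler_sqr R) ?nnegrE ?(ltW s0) // s2 rE lerDr sqr_ge0.
have sr : sb x <= 2 * r.
  rewrite -(@ler_sqr R) ?nnegrE ?(ltW s0) ?mulr_ge0 // s2 -rE.
  have : n%:R * n%:R <= r * r by apply: ler_pM.
  by have := sqr_ge0 r; lra.
have : ln (sb x) <= ln (2 * r) by rewrite ler_ln ?posrE ?mulr_gt0.
rewrite lnM ?posrE // => /(ler_wpM2l a0).
by lra.
Qed.

End Weight.

(** * A Phragmen-Lindelof principle on a slab *)

(** In sin t = 2 sin (t / 2) cos (t / 2) both factors are controlled by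
    cos (pi / 4) as long as t <= pi / 2; the rest follows by symmetry. *)
Lemma sin_lower_bound (R : realType) : exists2 k : R, 0 < k &
  forall t : R, 0 <= t <= pi -> k * (t * (pi - t)) <= sin t.
Proof.
have p2 : 2 <= pi :> R := pi_ge2 R.
have p4 : pi < 4 :> R by have := pihalf_lt2 R; lra.
set c : R := cos (pi / 4).
have c0 : 0 < c by apply: cos_gt0_pihalf; apply/andP; split; lra.
have cosc (y : R) : 0 <= y <= pi / 4 -> c <= cos y.
  move=> /andP[y0 y4]; rewrite leNgt ltr_cos ?in_itv /=; last 2 first.
  - by apply/andP; split; lra.
  - by apply/andP; split; lra.
  by rewrite -leNgt.
have small (t : R) : 0 <= t <= pi / 2 -> c ^+ 2 / 4 * (t * (pi - t)) <= sin t.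
  move=> /andP[t0 t1].
  have [z] : exists2 z : R, z \in `[0, t / 2]%R &
      sin (t / 2) - sin 0 = cos z * (t / 2 - 0).
    apply: (@MVT_segment R (@sin R) (@cos R)).
    - by lra.
    - by apply: continuous_subspaceT; exact: continuous_sin.
  rewrite in_itv /= sin0 !subr0 => /andP[z0 zt] sE.
  have h1 : c * (t / 2) <= sin (t / 2).
    by rewrite sE ler_wpM2r ?divr_ge0 // cosc //; apply/andP; split; lra.
  have h2 : c <= cos (t / 2) by apply: cosc; apply/andP; split; lra.
  have -> : sin t = 2 * (sin (t / 2) * cos (t / 2)).
    have tE : t = t / 2 + t / 2 by field.
    by rewrite {1}tE sinD; ring.
  have h3 : c * (t / 2) * c <= sin (t / 2) * cos (t / 2).
    by apply: ler_pM => //; [rewrite mulr_ge0 ?divr_ge0 // ltW|exact: ltW].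
  have h4 : c ^+ 2 * t * (pi - t) <= c ^+ 2 * t * 4.
    by rewrite ler_wpM2l ?mulr_ge0 ?sqr_ge0 //; lra.
  by lra.
exists (c ^+ 2 / 4); first by rewrite divr_gt0 // exprn_gt0.
move=> t /andP[t0 tp]; have [th|th] := leP t (pi / 2).
  by apply: small; rewrite t0.
have -> : sin t = sin (pi - t) by rewrite sinB sinpi cospi; ring.
have -> : t * (pi - t) = (pi - t) * (pi - (pi - t)) by ring.
by apply: small; apply/andP; split; lra.
Qed.

Section PhragmenLindelof.
Variables (R : realType) (n : nat) (i0 : 'I_n).
Local Notation V := 'rV[R]_n.
Local Notation ev := (@basis_vector R n).
Implicit Types (f g k v w : V -> R) (x c z : V).
Hypothesis n2 : (1 < n)%N.
Local Notation U := (@weight R n i0).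
Local Notation ysq := (@axis_sq R n i0).

(** The second derivative of sine contributes - U, which outweighs lap U. *)
Lemma laplace_sin_weight x : 0 < sin (x 0 i0) ->
  exists2 l, laplace_at (fun z => sin (z 0 i0) * U z) x l & l < 0.
Proof.
move=> s0; have [p [q [jU p0 qU]]] := weight_supersolution i0 n2 x.
have js i : jet (@sin R \o (fun z : V => z 0 i0)) x (ev i)
    (cos (x 0 i0) * (i0 == i)%:R)
    (- sin (x 0 i0) * (i0 == i)%:R ^+ 2 + cos (x 0 i0) * 0).
  exact: (@jet_comp_total _ _ (@sin R) (@cos R) _ _ _ _ _ _ (jet_coord i0 i x)
    (fun z => is_derive_sin _) (is_derive_cos _)).
eexists.
  by eexists; eexists; split=> [i|]; [exact: jetM (js i) (jU i)|reflexivity].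
rewrite (eq_bigr (fun i => sin (x 0 i0) * (q i - (i0 == i)%:R * U x))); last first.
  move=> i _ /=; case: eqP => [<-|_] /=; last by ring.
  by rewrite p0; ring.
rewrite -mulr_sumr pmulr_rlt0 // sumrB.
have -> : \sum_i (i0 == i)%:R * U x = U x.
  rewrite (bigD1 i0) //= eqxx mul1r big1 ?addr0 // => i.
  by rewrite eq_sym => /negPf ->; rewrite mul0r.
by rewrite subr_lt0.
Qed.

Lemma weight_continuous x : {for x, continuous U}.
Proof.
apply: (@continuous_comp _ _ _ (fun z => axis_bracket i0 z
  - decay_exponent R n * ln (axis_bracket i0 z)) expR); last first.
  exact: continuous_expR.
have sc : {for x, continuous (axis_bracket (R := R) i0)}.
  apply: (@continuous_comp _ _ _ (fun z => n%:R ^+ 2 + axis_sq i0 z)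
    (@Num.sqrt R)).
    apply: continuous_forD; first exact: continuous_for_cst.
    exact: quad_continuous.
  exact: sqrt_continuous.
apply: continuous_forD => //; apply: continuous_forN.
apply: continuous_forM; first exact: continuous_for_cst.
apply: (@continuous_comp _ _ _ (axis_bracket i0) (@ln R)) => //.
exact/continuous_ln/axis_bracket_gt0.
Qed.

(** For every [e > 0] the function f - e sin t U is nonpositive on the faces of
    the slab and far from the axis, and its Laplacian is positive in between,
    so that it has no positive maximum. *)
Lemma phragmen_lindelof f :
  (forall x, 0 <= x 0 i0 <= pi -> {for x, continuous f}) ->
  (forall x, 0 < x 0 i0 < pi -> laplace_at f x 0) ->
  (forall x, x 0 i0 = 0 \/ x 0 i0 = pi -> f x = 0) ->
  (forall e : R, 0 < e -> exists L, forall x, 0 < x 0 i0 < pi -> L < ysq x ->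
     f x <= e * (sin (x 0 i0) * U x)) ->
  forall x, 0 <= x 0 i0 <= pi -> f x <= 0.
Proof.
move=> fc fl f0 fU x xs.
have main (e : R) : 0 < e -> f x <= e * (sin (x 0 i0) * U x).
  move=> e0; have [L LP] := fU e e0.
  pose M := 1 + `|L| + \sum_(i < n) `|x 0 i|.
  have S0 : 0 <= \sum_(i < n) `|x 0 i| by apply: sumr_ge0.
  have M1 : 1 <= M by have := normr_ge0 L; rewrite /M; lra.
  have ML : L < M ^+ 2.
    have : M * 1 <= M * M by apply: ler_pM; lra.
    by have := ler_norm L; rewrite /M in M1 *; lra.
  have xM i : `|x 0 i| <= M.
    rewrite /M (bigD1 i) //=.
    have : 0 <= \sum_(j < n | j != i) `|x 0 j| by apply: sumr_ge0.
    by have := normr_ge0 L; lra.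
  pose w z := f z + (- e) * (sin (z 0 i0) * U z).
  suff : w x <= 0 by rewrite /w mulNr subr_le0.
  pose a i : R := if i == i0 then 0 else - M.
  pose b i : R := if i == i0 then pi else M.
  have Kx : box a b x.
    by move=> i; rewrite /a /b; case: eqP => [->//|_]; rewrite -ler_norml.
  apply: (max_principle (w := w) (box_compact (a := a) (b := b)) _ _ Kx).
    move=> z Kz; have := Kz i0; rewrite /a /b eqxx => zs.
    apply: continuous_forD; first exact: fc.
    apply: continuous_forM; first exact: continuous_for_cst.
    apply: continuous_forM; last exact: weight_continuous.
    apply: (@continuous_comp _ _ _ (fun y : V => y 0 i0) (@sin R)).
      exact: coord_continuous.
    exact: continuous_sin.
  move=> z Kz wz.
  have /andP[z0 zp] : 0 <= z 0 i0 <= pi by have := Kz i0; rewrite /a /b eqxx.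
  have {}z0 : 0 < z 0 i0.
    rewrite lt_neqAle z0 andbT; apply/eqP => E; move: wz.
    by rewrite /w f0 -?E ?sin0 ?mul0r ?mulr0 ?addr0 ?ltxx //; left.
  have {}zp : z 0 i0 < pi.
    rewrite lt_neqAle zp andbT; apply/eqP => E; move: wz.
    by rewrite /w f0 ?E ?sinpi ?mul0r ?mulr0 ?addr0 ?ltxx //; right.
  have zs : 0 < z 0 i0 < pi by rewrite z0.
  split.
    apply: box_nbhs => i; rewrite /a /b; case: eqP => [->//|/eqP ii0].
    have := Kz i; rewrite /a /b (negPf ii0) -ler_norml -ltr_norml le_eqVlt.
    move=> /predU1P[zM|//]; move: wz; rewrite ltNge /w mulNr subr_le0 LP //.
    apply: lt_le_trans ML _; rewrite -zM real_normK ?num_real //.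
    exact: axis_sq_coord.
  have [l ll l0] := laplace_sin_weight (sin_gt0_pi zs).
  exists (0 + (- e) * l); first exact: laplace_atD (fl _ zs) (laplace_atZ _ ll).
  by rewrite add0r mulNr -mulrN mulr_gt0 // oppr_gt0.
rewrite leNgt; apply/negP => fx.
have S0 : 0 <= sin (x 0 i0) * U x.
  by rewrite mulr_ge0 ?sin_ge0_pi // ltW // weight_gt0.
have e0 : 0 < f x / (2 * (1 + sin (x 0 i0) * U x)).
  by rewrite divr_gt0 // mulr_gt0 //; lra.
have := main _ e0; apply/negP; rewrite -ltNge.
set S := sin _ * U x in S0 *.
rewrite mulrAC ltr_pdivrMr; last by rewrite mulr_gt0 //; lra.
have : 0 <= f x * S by rewrite mulr_ge0 // ltW.
by lra.
Qed.

End PhragmenLindelof.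

(** * Reflections *)

Lemma continuous_reflection (R : realType) (V : normedModType R) (l : V -> R)
    (c : R) (e : V) : continuous l ->
  continuous (fun x => x + (c - 2 * l x) *: e).
Proof.
move=> lc x; apply: cvgD; first exact: cvg_id.
apply: cvgZr_tmp; apply: cvgB; first exact: cvg_cst.
by apply: cvgM; [exact: cvg_cst|exact: lc].
Qed.

Section Reflection.
Variables (R : realType) (n : nat) (i0 : 'I_n).
Local Notation V := 'rV[R]_n.
Local Notation ev := (@basis_vector R n).
Implicit Types (f g : V -> R) (x z : V).

(** Reflection in the hyperplane where the coordinate [i0] is [c / 2]. *)
Definition mirror (c : R) x : V := x + (c - 2 * x 0 i0) *: ev i0.

Lemma mirror_i0 c x : mirror c x 0 i0 = c - x 0 i0.
Proof. by rewrite !mxE !eqxx /= mulr1; ring. Qed.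

Lemma mirror_other c x i : i != i0 -> mirror c x 0 i = x 0 i.
Proof. by move=> /negPf ii0; rewrite !mxE ii0 andbF mulr0 addr0. Qed.

Lemma mirrorK c x : mirror c (mirror c x) = x.
Proof.
apply/rowP => i; have [->|ii0] := eqVneq i i0.
  by rewrite !mirror_i0; ring.
by rewrite !mirror_other.
Qed.

Lemma mirror_fixed c x : x 0 i0 = c / 2 -> mirror c x = x.
Proof.
move=> xc; apply/rowP => i; have [->|ii0] := eqVneq i i0.
  by rewrite mirror_i0 xc; field.
by rewrite mirror_other.
Qed.

Lemma mirror_continuous c : continuous (mirror c).
Proof.
exact: continuous_reflection (ev i0) (@coord_continuous R 1 n 0 i0).
Qed.

(** A reflection reverses the sign of one first derivative and preserves all
    pure second derivatives. *)
Lemma laplace_at_mirror c f x l :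
  laplace_at f (mirror c x) l -> laplace_at (f \o mirror c) x l.
Proof.
move=> [p [q [fj <-]]].
pose s i : R := if i == i0 then -1 else 1.
exists (fun i => s i * p i), q; split=> // i.
apply: jet_reflect (fj i); first exact: mirror_continuous.
  move=> h y; apply/rowP => j; rewrite /s.
  have [ii0|ii0] := eqVneq i i0; have [ji0|ji0] := eqVneq j i0.
  - by rewrite ii0 ji0 mirror_i0 !mxE !eqxx andTb; rewrite /=; ring.
  - by rewrite ii0 mirror_other // !mxE (negPf ji0) andbF; rewrite /=; ring.
  - by rewrite ji0 mirror_i0 !mxE !eqxx andTb eq_sym (negPf ii0); rewrite /=; ring.
  - by rewrite mirror_other // !mxE (negPf ji0) andbF; rewrite /=; ring.
by rewrite /s; case: eqP => _; rewrite ?mulrNN mulr1.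
Qed.

Lemma axis_sq_mirror c x : axis_sq i0 (mirror c x) = axis_sq i0 x.
Proof.
by rewrite !axis_sqE; apply: eq_bigr => i ii0; rewrite mirror_other.
Qed.

Lemma weight_mirror c x : weight i0 (mirror c x) = weight i0 x.
Proof. by rewrite /weight /axis_bracket axis_sq_mirror. Qed.

End Reflection.

(** * Polyharmonic functions on a slab *)

Section HarmonicStrip.
Variables (R : realType) (n : nat) (i0 : 'I_n).
Local Notation V := 'rV[R]_n.
Implicit Types (f g : V -> R) (x z : V).
Hypothesis n2 : (1 < n)%N.
Local Notation U := (@weight R n i0).
Local Notation ysq := (@axis_sq R n i0).

(** The power of the distance to the faces of the slab is a parameter because
    it increases when [f] is replaced by its Laplacian. *)
Definition slow_growth (q : nat) f := forall e : R, 0 < e ->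
  exists L, forall x, 0 < x 0 i0 < pi -> L < ysq x ->
    `|f x| * (x 0 i0 * (pi - x 0 i0)) ^+ q <= e * U x.

Lemma axis_sq_near (L : R) : exists L', forall x z : V,
  (forall i, `|z 0 i - x 0 i| <= 1) -> L' < ysq x -> L < ysq z.
Proof.
pose M : R := n%:R + n%:R + 1 + `|L|.
have M0 : 0 <= M by have := ler0n R n; have := normr_ge0 L; rewrite /M; lra.
exists (M ^+ 2) => x z zx Lx.
have sx : M < axis_bracket i0 x.
  rewrite -(@ltr_sqr R) ?nnegrE ?sqrtr_ge0 // axis_bracket_sq.
  by have := sqr_ge0 (n%:R : R); lra.
have sz : n%:R + 1 + `|L| < axis_bracket i0 z.
  have : axis_bracket i0 x <= axis_bracket i0 z + n%:R.
    by apply: axis_bracket_near => i; rewrite distrC.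
  by move: sx; rewrite /M; lra.
have := axis_bracket_sq i0 z.
have L0 := normr_ge0 L; have n0 := ler0n R n.
have : (n%:R + 1 + `|L|) ^+ 2 <= axis_bracket i0 z ^+ 2.
  by apply: lerXn2r; rewrite ?nnegrE ?sqrtr_ge0 ?ltW //; lra.
have : 0 <= n%:R * `|L| by rewrite mulr_ge0.
have := sqr_ge0 `|L|; have := ler_norm L.
by lra.
Qed.

Definition harmonic_strip f := [/\
  forall x, 0 <= x 0 i0 <= pi -> {for x, continuous f},
  forall x, 0 < x 0 i0 < pi -> laplace_at f x 0 &
  forall x, x 0 i0 = 0 \/ x 0 i0 = pi -> f x = 0].

(** [boundary_decay] at the foot of [x] on the face, with the bound [M] of the
    size of the weight at [x]. *)
Lemma decay_near_face q f : harmonic_strip f -> slow_growth q f ->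
  forall e : R, 0 < e -> exists L, forall x, 0 < x 0 i0 <= 1 / 2 -> L < ysq x ->
    `|f x| <= e * (x 0 i0 * U x).
Proof.
move=> [fc fl f0] fg e e0.
have p2 : 2 <= pi :> R := pi_ge2 R.
have [C C0 decay] := boundary_decay R i0 q.
have [Ch Ch0 harnack] := weight_harnack R i0 n2.
have eta0 : 0 < e / (C * Ch) by rewrite divr_gt0 // mulr_gt0.
have [L LP] := fg _ eta0; have [L' L'P] := axis_sq_near L.
exists L' => x /andP[x0 x12] Lx.
pose c : V := \row_i if i == i0 then 0 else x 0 i.
have c0 : c 0 i0 = 0 by rewrite mxE eqxx.
have M0 : 0 < e / C * U x by rewrite !mulr_gt0 ?invr_gt0 ?weight_gt0.
have -> : e * (x 0 i0 * U x) = C * (e / C * U x) * x 0 i0 by field; rewrite gt_eqF.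
apply: (decay f c _ M0 c0) => [z Bz z0||i /negPf ii0]; last 2 first.
- by rewrite (ltW x0).
- by rewrite mxE ii0.
have zc i : `|z 0 i - c 0 i| <= 1.
  by have := le_trans (norm_coord (z - c) i) Bz; rewrite !mxE.
have z1 : z 0 i0 <= 1 by have := zc i0; rewrite c0 subr0 ger0_norm.
split.
- by apply: fc; rewrite z0 /=; lra.
- by move=> z00; apply: fl; rewrite z00 /=; lra.
- by move=> z00; apply: f0; left.
have [z00|z00] := leP (z 0 i0) 0.
  by rewrite f0 ?normr0 ?mul0r ?ltW //; left; apply/le_anti; rewrite z00.
have zx i : `|z 0 i - x 0 i| <= 1.
  have [->|ii0] := eqVneq i i0; first by rewrite ler_norml; apply/andP; split; lra.
  by have := zc i; rewrite mxE (negPf ii0).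
have zs : 0 < z 0 i0 < pi by rewrite z00 /=; lra.
have h := LP z zs (L'P x z zx Lx).
have : z 0 i0 ^+ q <= (z 0 i0 * (pi - z 0 i0)) ^+ q.
  apply: lerXn2r; rewrite ?nnegrE ?mulr_ge0 //; first by lra.
  by rewrite ler_peMr //; lra.
move=> /(ler_wpM2l (normr_ge0 (f z))) /le_trans; apply; apply: le_trans h _.
have -> : e / C * U x = e / (C * Ch) * (Ch * U x) by field; rewrite !gt_eqF.
by rewrite ler_wpM2l ?harnack // ltW.
Qed.

Lemma harmonic_strip_mirror f : harmonic_strip f ->
  harmonic_strip (f \o mirror i0 pi).
Proof.
move=> [fc fl f0]; split=> x xs.
- apply: (@continuous_comp _ _ _ (mirror i0 pi) f); first exact: mirror_continuous.
  by apply: fc; rewrite mirror_i0; lra.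
- by apply: laplace_at_mirror; apply: fl; rewrite mirror_i0; lra.
- by apply: f0; rewrite mirror_i0; case: xs => ->; [right|left]; ring.
Qed.

(** Near each face [f] decays linearly, like the sine, and away from the faces
    the distance factor is bounded below; hence [f] is negligible with respect
    to sin t U and [phragmen_lindelof] applies. *)
Lemma harmonic_strip_le0 q f : harmonic_strip f -> slow_growth q f ->
  forall x, 0 <= x 0 i0 <= pi -> f x <= 0.
Proof.
move=> fh fg; have [fc fl f0] := fh.
have p2 : 2 <= pi :> R := pi_ge2 R.
apply: (phragmen_lindelof n2 fc fl f0) => e e0.
have [k k0 sin_ge] := sin_lower_bound R.
have fg' : slow_growth q (f \o mirror i0 pi).
  move=> e' /fg[L LP]; exists L => x xs Lx.
  have := LP (mirror i0 pi x); rewrite axis_sq_mirror weight_mirror mirror_i0 /=.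
  have -> : (pi - x 0 i0) * (pi - (pi - x 0 i0)) = x 0 i0 * (pi - x 0 i0).
    by ring.
  by apply=> //; lra.
have ek : 0 < e * k by rewrite mulr_gt0.
have [L1 L1P] := decay_near_face fh fg ek.
have [L2 L2P] := decay_near_face (harmonic_strip_mirror fh) fg' ek.
have e4 : 0 < e * k / 4 / 4 ^+ q by rewrite !divr_gt0 // exprn_gt0.
have [L3 L3P] := fg _ e4.
exists (Num.max L1 (Num.max L2 L3)) => x xs.
rewrite !gt_max => /and3P[x1 x2 x3].
have xs' : 0 <= x 0 i0 <= pi by lra.
have sx := sin_ge _ xs'; have U0 := weight_gt0 i0 x.
apply: le_trans (ler_norm _) _.
set t := x 0 i0 in xs xs' sx *.
suff : `|f x| <= e * (k * (t * (pi - t)) * U x).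
  by move=> /le_trans; apply; rewrite ler_pM2l // ler_pM2r.
have [t1|t1] := leP t (1 / 2).
  have := L1P x; rewrite -/t => /(_ _ x1); rewrite t1 andbT.
  move=> /(_ _)/le_trans; apply.
    by case/andP: xs.
  have : e * k * (t * U x) * 1 <= e * k * (t * U x) * (pi - t).
    by rewrite ler_wpM2l ?mulr_ge0 ?ltW //; lra.
  by lra.
have [t2|t2] := leP (pi - t) (1 / 2).
  have := L2P (mirror i0 pi x).
  rewrite /= mirrorK axis_sq_mirror weight_mirror mirror_i0 -/t.
  move=> /(_ _ x2); rewrite t2 andbT => /(_ _)/le_trans; apply; first by lra.
  have : e * k * ((pi - t) * U x) * 1 <= e * k * ((pi - t) * U x) * t.
    by rewrite ler_wpM2l ?mulr_ge0 ?(ltW U0) ?(ltW e0) ?(ltW k0) //; lra.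
  by lra.
have w4 : 1 / 4 <= t * (pi - t).
  have : 0 <= (t - 1 / 2) * (pi - t - 1 / 2) by apply: mulr_ge0; lra.
  by lra.
have h1 := L3P x xs x3; rewrite -/t in h1.
have h2 : (1 / 4) ^+ q <= (t * (pi - t)) ^+ q.
  by apply: lerXn2r; rewrite ?nnegrE //; lra.
have h3 := le_trans (ler_wpM2l (normr_ge0 (f x)) h2) h1.
have h4 : `|f x| <= e * k / 4 * U x.
  move: h3; rewrite expr_div_n expr1n mul1r ler_pdivrMr ?exprn_gt0 //.
  move=> /le_trans; apply.
  by rewrite mulrAC divfK // expf_neq0.
apply: le_trans h4 _.
have : e * k * U x * (1 / 4) <= e * k * U x * (t * (pi - t)).
  by rewrite ler_wpM2l // !mulr_ge0 // ltW.
by lra.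
Qed.

Lemma harmonic_strip_eq0 q f : harmonic_strip f -> slow_growth q f ->
  forall x, 0 <= x 0 i0 <= pi -> f x = 0.
Proof.
move=> fh fg x xs; apply/le_anti; rewrite (harmonic_strip_le0 fh fg xs) /=.
rewrite -oppr_le0; have [fc fl f0] := fh.
apply: (harmonic_strip_le0 (f := fun z => - f z) (q := q) _ _ xs).
  split=> z zs; first by apply: continuous_forN; exact: fc.
    by rewrite -oppr0; exact: laplace_atN (fl z zs).
  by rewrite f0 ?oppr0.
by move=> e /fg[L LP]; exists L => z zs zL; rewrite normrN; exact: LP.
Qed.

(** The interior bound on a cube whose radius is proportional to the distance to
    the faces costs the square of that distance. *)
Lemma slow_growth_laplace q N f g :
  (forall x, 0 < x 0 i0 < pi -> {for x, continuous f}) ->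
  (forall x, 0 < x 0 i0 < pi -> laplace_at f x (g x)) ->
  polyharmonic_chain N g [set x | 0 < x 0 i0 < pi] ->
  slow_growth q f -> slow_growth (q + 2) g.
Proof.
move=> fc fl gN fg e e0.
have p2 : 2 <= pi :> R := pi_ge2 R.
have p4 : pi < 4 :> R by have := pihalf_lt2 R; lra.
have [C C0 bound] := laplacian_interior_bound R N (ltnW n2).
have [Ch Ch0 harnack] := weight_harnack R i0 n2.
pose D : R := 64 * C * Ch * 4 ^+ q.
have D0 : 0 < D by rewrite !mulr_gt0 // exprn_gt0.
have eD : 0 < e / D by rewrite divr_gt0.
have [L LP] := fg _ eD; have [L' L'P] := axis_sq_near L.
exists L' => x xs Lx; set t := x 0 i0 in xs *.
have /andP[t0 tp] := xs.
pose w := t * (pi - t).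
have w0 : 0 < w by rewrite mulr_gt0 // subr_gt0.
have wt : w / 8 <= t / 2.
  have : t * (pi - t) <= t * 4 by rewrite ler_wpM2l //; lra.
  by rewrite /w; lra.
have wpt : w / 8 <= (pi - t) / 2.
  have : t * (pi - t) <= 4 * (pi - t) by rewrite ler_wpM2r //; lra.
  by rewrite /w; lra.
have w1 : w / 8 <= 1 by lra.
(* within the radius [w / 8] the distances to the faces change at most by a
   factor 2 *)
have r0 : 0 < w / 8 by rewrite divr_gt0.
have U0 := weight_gt0 i0 x.
pose S := e / D * (Ch * U x) / (w / 4) ^+ q.
have S0 : 0 < S.
  by rewrite divr_gt0 ?exprn_gt0 ?divr_gt0 // !mulr_gt0 // invr_gt0.
have near z : cube x (w / 8) z -> (forall i, `|z 0 i - x 0 i| <= 1) /\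
    [/\ 0 < z 0 i0 < pi & w / 4 <= z 0 i0 * (pi - z 0 i0)].
  move=> Bz; have zi i : `|z 0 i - x 0 i| <= w / 8.
    by have := le_trans (norm_coord (z - x) i) Bz; rewrite !mxE.
  split; first by move=> i; exact: le_trans (zi i) w1.
  have := zi i0; rewrite -/t ler_norml => /andP[z1 z2].
  split; first by apply/andP; split; lra.
  rewrite (_ : w / 4 = (t / 2) * ((pi - t) / 2)); last by rewrite /w; field.
  by apply: ler_pM; lra.
have := bound f g x (w / 8) S r0 S0.
have fball z : cube x (w / 8) z ->
    [/\ {for z, continuous f}, laplace_at f z (g z) & `|f z| <= S].
  move=> /near[zx [zs wz]]; split; [exact: fc|exact: fl|].
  have h := LP z zs (L'P x z zx Lx).
  have h2 : (w / 4) ^+ q <= (z 0 i0 * (pi - z 0 i0)) ^+ q.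
    by apply: lerXn2r; rewrite ?nnegrE //; lra.
  rewrite ler_pdivlMr ?exprn_gt0 ?divr_gt0 //.
  apply: le_trans (ler_wpM2l (normr_ge0 (f z)) h2) _.
  by apply: le_trans h _; rewrite ler_wpM2l ?harnack // ltW.
move=> /(_ fball) h.
have {}h : `|g x| * (w / 8) ^+ 2 <= C * S.
  by apply: h; apply: polyharmonic_chain_sub gN => z /near[_ []].
rewrite -/w exprD mulrCA.
have -> : w ^+ q * (`|g x| * w ^+ 2) = `|g x| * (w / 8) ^+ 2 * (64 * w ^+ q).
  by field.
have wq0 : 0 < w ^+ q by rewrite exprn_gt0.
apply: le_trans (ler_wpM2r _ h) _; first by rewrite mulr_ge0 // ltW.
rewrite le_eqVlt; apply/orP; left; apply/eqP.
rewrite /S /D expr_div_n; field.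
by rewrite !gt_eqF ?exprn_gt0.
Qed.

Definition open_strip (del : R) := [set x : V | - pi - del < x 0 i0 < pi + del].

Lemma open_stripE del z :
  open_strip del z = (- pi - del < z 0 i0 < pi + del) :> Prop.
Proof. by []. Qed.

(** Induction on the order.  The Laplacian [g] of [f] is odd with respect to the
    same hyperplanes and grows slowly with the exponent [q + 2], so [g] vanishes
    and [f] is harmonic; oddness gives [f = 0] on both faces. *)
Lemma polyharmonic_strip_eq0 (del : R) N : 0 < del -> forall q f,
  polyharmonic_chain N f (open_strip del) ->
  (forall c x, c = 0 \/ c = 2 * pi -> - pi - del < x 0 i0 < pi + del ->
     - pi - del < c - x 0 i0 < pi + del -> f (mirror i0 c x) = - f x) ->
  slow_growth q f -> forall x, 0 <= x 0 i0 <= pi -> f x = 0.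
Proof.
move=> del0; have p2 : 2 <= pi :> R := pi_ge2 R.
set S := open_strip del.
have SP x : 0 <= x 0 i0 <= pi -> S x.
  by move=> /andP[? ?]; rewrite /S open_stripE; apply/andP; split; lra.
elim: N => [|N IH] q f /= [fc].
  by move=> f0 _ _ x /SP; exact: f0.
move=> [g fl gN] f_odd fg.
have S_open x : S x -> nbhs x S.
  move=> Sx; have xc : (fun z : V => z 0 i0) @ x --> x 0 i0.
    exact: coord_continuous.
  have /andP[x1 x2] : - pi - del < x 0 i0 < pi + del := Sx.
  by apply: (@filterS2 _ (nbhs x) (nbhs_filter x)) (cvgr_gt _ xc _ x1)
    (cvgr_lt _ xc _ x2) => z z1 z2; apply/andP.
have g_odd c x : c = 0 \/ c = 2 * pi -> - pi - del < x 0 i0 < pi + del ->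
     - pi - del < c - x 0 i0 < pi + del -> g (mirror i0 c x) = - g x.
  move=> cc Sx Srx.
  have Srx' : S (mirror i0 c x) by rewrite /S open_stripE mirror_i0.
  apply: (@laplace_at_unique _ _ (f \o mirror i0 c) x).
    by apply: laplace_at_mirror; exact: fl.
  apply: laplace_at_near (laplace_atN (fl _ Sx)).
  have rS : nbhs x (mirror i0 c @^-1` S).
    exact: mirror_continuous (S_open _ Srx').
  apply: (@filterS2 _ (nbhs x) (nbhs_filter x)) (S_open _ Sx) rS => z Sz Srz /=.
  rewrite f_odd //.
  by have : S (mirror i0 c z) := Srz; rewrite /S open_stripE mirror_i0.
have sub : [set x : V | 0 < x 0 i0 < pi] `<=` S.
  by move=> x /andP[? ?]; apply: SP; rewrite !ltW.
have gg : slow_growth (q + 2) g.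
  apply: (slow_growth_laplace (N := N) _ _ _ fg).
  - by move=> x /sub; exact: fc.
  - by move=> x /sub; exact: fl.
  - exact: polyharmonic_chain_sub gN.
have g0 := IH _ _ gN g_odd gg.
apply: (harmonic_strip_eq0 (q := q)) => //; split=> x xs.
- exact/fc/SP.
- by rewrite -(g0 x); [exact/fl/sub|case/andP: xs => ? ?; rewrite !ltW].
- have {}xs : exists2 c, c = 0 \/ c = 2 * pi & x 0 i0 = c / 2.
    case: xs => ->; first by exists 0; [left|rewrite mul0r].
    by exists (2 * pi); [right|field].
  case: xs => c cc xc.
  have : f (mirror i0 c x) = - f x.
    by apply: f_odd => //; case: cc => cE; rewrite xc cE; lra.
  rewrite mirror_fixed // => /eqP; rewrite -subr_eq0 opprK -mulr2n mulrn_eq0 /=.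
  by move/eqP.
Qed.

End HarmonicStrip.

(** * From complex-valued to real-valued functions *)

Lemma near_eq_continuous (T U : topologicalType) (F H : T -> U) (x : T) :
  (\forall z \near x, F z = H z) -> {for x, continuous F} ->
  {for x, continuous H}.
Proof.
move=> FH Fc; rewrite /prop_for /continuous_at -(nbhs_singleton FH).
by apply: cvg_trans Fc; apply: near_eq_cvg.
Qed.

(** The functions [phi] of interest are the real and the imaginary part. *)
Section ContractionDerivative.
Variables (R : realType) (V W : normedModType R) (phi : {linear W -> R}).
Hypothesis phi_le : forall z, `|phi z| <= `|z|.

Lemma contraction_continuous : continuous phi.
Proof.
move=> z; apply/cvgrPdist_lt => e e0.
have zc : (fun w : W => w) @ z --> z by exact: cvg_id.
have : \forall w \near z, `|z - w| < e by exact: cvgr_dist_lt zc _ e0.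
by apply: filterS => w; apply: le_lt_trans; rewrite -raddfB; exact: phi_le.
Qed.

Lemma is_derive_contraction (F : V -> W) x e D :
  is_derive x e F D -> is_derive x e (phi \o F) (phi D).
Proof.
move=> [dF DF].
have lim : (fun h : R => h^-1 *:
    (((phi \o F) \o shift x) (h *: e) - (phi \o F) x)) @ 0^' --> phi D.
  rewrite (_ : (fun h : R => _) =
     phi \o (fun h : R => h^-1 *: ((F \o shift x) (h *: e) - F x))).
    apply: continuous_cvg; first exact: contraction_continuous.
    rewrite -DF; exact: dF.
  apply/funext => h /=; rewrite linearZ /=; congr (_ *: _).
  by rewrite raddfB.
split; first by apply/cvg_ex; exists (phi D).
by rewrite /derive; apply/cvg_lim => //; exact: Rhausdorff.
Qed.

End ContractionDerivative.

Section Bridge.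
Variables (R : realType) (n : nat).
Local Notation C := (Rcomplex R).
Local Notation V := 'rV[R]_n.
Implicit Types (F H : V -> C) (G : set V).

Lemma cdiff_continuous k F G x : continuously_differentiable k F G -> G x ->
  {for x, continuous F}.
Proof. by case: k => [|k] [Fc _]; exact: Fc. Qed.

Lemma open_near G x (P : V -> Prop) : open G -> G x ->
  (forall z, G z -> P z) -> \forall z \near x, P z.
Proof.
move=> Go Gx GP.
exact: (@filterS _ (nbhs x) (nbhs_filter x)) (open_nbhs_nbhs (conj Go Gx)).
Qed.

(** Needed because the rules of differentiation identify partial derivatives on
    [G] only, whereas [partial] is a function on the whole space. *)
Lemma cdiff_ext k F H G : open G -> (forall x, G x -> F x = H x) ->
  continuously_differentiable k F G -> continuously_differentiable k H G.
Proof.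
move=> Go; elim: k F H => [|k IH] F H FH [Fc Fd]; split=> //.
- move=> x Gx; apply: near_eq_continuous (Fc x Gx); exact: open_near FH.
- move=> x Gx; apply: near_eq_continuous (Fc x Gx); exact: open_near FH.
move=> i; have [Fi Fik] := Fd i; split.
  move=> x Gx; apply: near_eq_derivable (Fi x Gx); exact: open_near FH.
apply: IH Fik => x Gx; apply: near_eq_derive; exact: open_near FH.
Qed.

Lemma cdiffD k F H G : open G -> continuously_differentiable k F G ->
  continuously_differentiable k H G ->
  continuously_differentiable k (fun x => F x + H x) G.
Proof.
move=> Go; elim: k F H => [|k IH] F H [Fc Fd] [Hc Hd]; split=> //.
- by move=> x Gx; apply: continuousD; [exact: Fc|exact: Hc].
- by move=> x Gx; apply: continuousD; [exact: Fc|exact: Hc].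
move=> i; have [Fi Fik] := Fd i; have [Hi Hik] := Hd i; split.
  by move=> x Gx; apply: derivableD; [exact: Fi|exact: Hi].
apply: cdiff_ext (IH _ _ Fik Hik) => // x Gx.
by rewrite /partial deriveD //; [exact: Fi|exact: Hi].
Qed.

Lemma cdiff0 k G : continuously_differentiable k (fun=> 0 : C) G.
Proof.
have c0 x : {for x, continuous ((fun=> 0) : V -> C)}.
  by move: x; exact: cst_continuous.
elim: k => [|k IH]; split=> // i; split; first by move=> x _; exact: derivable_cst.
have -> : partial i (fun=> 0 : C) = (fun=> 0) :> (V -> C).
  by apply/funext => x; exact: derive_cst.
exact: IH.
Qed.

Lemma cdiff_laplacian k F G : open G ->
  continuously_differentiable k.+2 F G ->
  continuously_differentiable k (laplacian F) G.
Proof.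
move=> Go [_ Fd].
have Fii i : continuously_differentiable k (partial i (partial i F)) G.
  by have [_ [_ /(_ i)[]]] := Fd i.
rewrite /laplacian; elim: (index_enum _) => [|i r IH].
  by apply: cdiff_ext (cdiff0 k G) => // x _; rewrite big_nil.
by apply: cdiff_ext (cdiffD Go (Fii i) IH) => // x _; rewrite big_cons.
Qed.

Lemma polyharmonic_component (phi : {linear C -> R}) N F G :
  (forall z, `|phi z| <= `|z|) -> open G -> polyharmonic N F G ->
  polyharmonic_chain N (phi \o F) G.
Proof.
move=> phi_le Go; elim: N F => [|N IH] F [Fd F0].
  split=> x Gx; last by have /= -> := F0 x Gx; rewrite raddf0.
  apply: continuous_comp; first exact: cdiff_continuous Fd Gx.
  exact: contraction_continuous.
rewrite mul2n doubleS -mul2n in Fd.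
split.
  move=> x Gx; apply: continuous_comp; first exact: cdiff_continuous Fd Gx.
  exact: contraction_continuous.
exists (phi \o laplacian F); last first.
  apply: IH; split; first exact: cdiff_laplacian.
  by move=> x Gx; rewrite -iterSr; exact: F0.
move=> x Gx; exists (fun i => phi (partial i F x)),
  (fun i => phi (partial i (partial i F) x)); split; last by rewrite /= raddf_sum.
move=> i; have [Fi [_ Fii]] := Fd.2 i.
exists (phi \o partial i F); split=> //.
  apply: (open_near Go Gx) => z Gz.
  apply: is_derive_contraction => //; exact: derivableP (Fi z Gz).
by apply: is_derive_contraction => //; exact: derivableP ((Fii i).1 x Gx).
Qed.

End Bridge.

(** * The strip and the growth condition *)

Section Strip.
Variables (R : realType) (d : nat).
Local Notation C := (Rcomplex R).
Local Notation V := 'rV[R]_(1 + d).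
Local Notation i0 := (lshift d (0 : 'I_1)).

Lemma stripE (del : R) :
  strip (- pi - del) (pi + del) = open_strip i0 del :> set V.
Proof. by apply/seteqP; split=> x; rewrite /strip /open_strip /= mxE. Qed.

Lemma open_strip_open (del : R) : open (open_strip i0 del : set V).
Proof.
rewrite (_ : open_strip i0 del =
  (fun x : V => x 0 i0) @^-1` `]- pi - del, pi + del[).
  apply: open_comp; last exact: interval_open.
  by move=> x _; exact: coord_continuous.
by apply/seteqP; split=> x /=; rewrite in_itv.
Qed.

Lemma lsubmx_mirror (c : R) (x : V) : lsubmx (mirror i0 c x) 0 0 = c - lsubmx x 0 0.
Proof. by rewrite [LHS]mxE mirror_i0 mxE. Qed.

Lemma rsubmx_mirror (c : R) (x : V) : rsubmx (mirror i0 c x) = rsubmx x.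
Proof.
by apply/rowP => j; rewrite [LHS]mxE [RHS]mxE mirror_other.
Qed.

Lemma axis_sq_rsubmx (x : V) : axis_sq i0 x = euclidean_norm (rsubmx x) ^+ 2.
Proof.
rewrite sqr_sqrtr; last by apply: sumr_ge0 => j _; exact: sqr_ge0.
rewrite axis_sqE big_split_ord /= big1 ?add0r => [|i].
  by apply: eq_big => // j _; rewrite mxE.
by rewrite (ord1 i) eqxx.
Qed.

Lemma on_joint_row_mx (h : R -> 'rV[R]_d -> C) t y :
  on_joint h (row_mx t%:M y) = h t y.
Proof. by rewrite /on_joint row_mxKl row_mxKr mxE eqxx. Qed.

(** Each member of the supremum is below it, and its product with the inverse of
    [f] is eventually below [e]. *)
Lemma le_little_o_real (A : R -> 'rV[R]_d -> R) (D : set R) (f : R -> R) :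
  (forall r, 0 < r -> 0 < f r) ->
  le_little_o (fun y => ereal_sup [set (A t y)%:E | t in D]) f ->
  forall e : R, 0 < e -> exists L : R, 0 <= L /\ forall t y, D t ->
    L < euclidean_norm y -> A t y <= e * f (euclidean_norm y).
Proof.
move=> f0 H e e0.
have e0' : (0%:E < e%:E)%E by rewrite lte_fin.
have [M _ MP] := H _ (open_ereal_lt' e0').
exists (Num.max 0 M); rewrite le_max lexx; split=> // t y Dt.
rewrite gt_max => /andP[y0 yM].
have /= := MP y yM; have fy := f0 _ y0.
have sup : ((A t y)%:E <= ereal_sup [set (A s y)%:E | s in D])%E.
  by apply: ereal_sup_ubound; exists t.
have fV : (0 <= ((f (euclidean_norm y))^-1)%:E)%E by rewrite lee_fin invr_ge0 ltW.
move=> /(le_lt_trans (lee_wpmul2r fV sup)).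
by rewrite -EFinM lte_fin ltr_pdivrMr // => /ltW.
Qed.

(** On 0 < t < pi the factor t (pi ^ 2 - t ^ 2) is at least t (pi - t). *)
Lemma slow_growth_component (h : R -> 'rV[R]_d -> C) (phi : {linear C -> R}) :
  (1 <= d)%N -> (forall z, `|phi z| <= `|z|) ->
  le_little_o (fun y => ereal_sup
      [set (`|(t * (pi ^+ 2 - t ^+ 2)) *: h t y|)%:E | t in `[- pi, pi]])
    (fun r => r `^ ((1 - d%:R) / 2) * expR r) ->
  slow_growth i0 1 (phi \o on_joint h).
Proof.
move=> d1 phi_le hg e e0.
have n2 : (1 < 1 + d)%N by rewrite ltnS.
have [K K0 KP] := growth_le_weight R i0 n2.
have eK : 0 < e / K by rewrite divr_gt0.
have [|L [L0 LP]] := le_little_o_real _ hg eK.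
  by move=> r r0; rewrite mulr_gt0 ?powR_gt0 ?expR_gt0.
exists ((L + (1 + d)%:R) ^+ 2) => x xs.
rewrite axis_sq_rsubmx; set r := euclidean_norm _ => Lr.
have r0 : 0 <= r by exact: sqrtr_ge0.
have {}Lr : L + (1 + d)%:R < r.
  by rewrite -(@ltr_sqr R) ?nnegrE // addr_ge0.
have n0 := ler0n R (1 + d).
have Lr' : L < r by lra.
set t := x 0 i0 in xs *; have /andP[t0 tp] := xs.
have tE : lsubmx x 0 0 = t by rewrite mxE.
have Dt : (`[- pi, pi]%classic : set R) t.
  by rewrite /= in_itv /=; apply/andP; split; lra.
have := LP t (rsubmx x) Dt Lr'; rewrite -/r normrZ.
rewrite expr1 /= /on_joint tE; set z := h t _ => h1.
have h2 : r `^ ((1 - d%:R) / 2) * expR r <= K * weight i0 x.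
  have -> : (1 - d%:R) / 2 = - decay_exponent R (1 + d).
    by rewrite /decay_exponent natrD; field.
  by apply: KP => //; [rewrite axis_sq_rsubmx|lra].
have p2 : 2 <= pi :> R := pi_ge2 R.
have w0 : 0 <= t * (pi - t) by rewrite mulr_ge0 //; lra.
have w1 : t * (pi - t) <= `|t * (pi ^+ 2 - t ^+ 2)|.
  apply: le_trans (ler_norm _).
  have : t * (pi - t) * 1 <= t * (pi - t) * (pi + t) by rewrite ler_wpM2l //; lra.
  by lra.
apply: (@le_trans _ _ (`|z| * `|t * (pi ^+ 2 - t ^+ 2)|)).
  by apply: ler_pM => //; exact: phi_le.
rewrite mulrC; apply: le_trans h1 _.
apply: le_trans (ler_wpM2l (ltW eK) h2) _.
by rewrite mulrA divfK // gt_eqF.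
Qed.

Lemma component_eq0 N (del : R) (h : R -> 'rV[R]_d -> C)
    (phi : {linear C -> R}) :
  (1 <= d)%N -> 0 < del -> (forall z, `|phi z| <= `|z|) ->
  polyharmonic N (on_joint h) (strip (- pi - del) (pi + del)) ->
  odd_at (- pi - del) (pi + del) h 0 ->
  odd_at (- pi - del) (pi + del) h pi ->
  le_little_o (fun y => ereal_sup
      [set (`|(t * (pi ^+ 2 - t ^+ 2)) *: h t y|)%:E | t in `[- pi, pi]])
    (fun r => r `^ ((1 - d%:R) / 2) * expR r) ->
  forall t y, 0 <= t <= pi -> phi (h t y) = 0.
Proof.
move=> d1 del0 phi_le hp odd0 oddpi hg t y tp.
have n2 : (1 < 1 + d)%N by rewrite ltnS.
rewrite -on_joint_row_mx.
have tE : (row_mx t%:M y : V) 0 i0 = t by rewrite row_mxEl mxE eqxx.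
apply: (@polyharmonic_strip_eq0 _ _ i0 n2 del N del0 1 (phi \o on_joint h)).
- rewrite -stripE; apply: polyharmonic_component => //.
  by rewrite stripE; exact: open_strip_open.
- move=> c x cc xs xs' /=; rewrite /on_joint lsubmx_mirror rsubmx_mirror.
  have -> : lsubmx x 0 0 = x 0 i0 by rewrite mxE.
  rewrite -raddfN; congr (phi _); move: cc => [] cE.
    have := odd0 (- x 0 i0) (rsubmx x); rewrite cE sub0r opprK !add0r; apply.
    by rewrite lt_min !ltr_norml; apply/andP; split; apply/andP; split; lra.
  have := oddpi (pi - x 0 i0) (rsubmx x).
  have -> : pi + (pi - x 0 i0) = c - x 0 i0 by rewrite cE; ring.
  have -> : pi - (pi - x 0 i0) = x 0 i0 by ring.
  apply; rewrite lt_min !ltr_norml; move: xs'; rewrite cE => xs'.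
  by apply/andP; split; apply/andP; split; lra.
- exact: slow_growth_component.
- by rewrite tE.
Qed.

End Strip.

(** Oddness at [0] and at [pi] makes [h] periodic of period [2 * pi] inside the
    strip; the induction is on the number of half periods. *)
Lemma odd_periodic_eq0 (R : realType) (d : nat) (del : R)
    (h : R -> 'rV[R]_d -> Rcomplex R) : 0 < del ->
  odd_at (- pi - del) (pi + del) h 0 ->
  odd_at (- pi - del) (pi + del) h pi ->
  (forall t y, 0 <= t <= pi -> h t y = 0) ->
  forall t y, - pi - del < t < pi + del -> h t y = 0.
Proof.
move=> del0 odd0 oddpi h0.
have p2 : 2 <= pi :> R := pi_ge2 R.
have neg t y : - pi - del < t < pi + del -> h (- t) y = 0 -> h t y = 0.
  move=> ts hN; have := odd0 t y.
  rewrite (add0r t) (sub0r t) hN => ->; first by rewrite oppr0.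
  by rewrite lt_min !ltr_norml; apply/andP; split; apply/andP; split; lra.
have pos (m : nat) t y : 0 <= t < pi + del -> t <= m%:R * pi -> h t y = 0.
  elim: m t => [|m IH] t ts tm.
    by apply: h0; rewrite mul0r in tm; lra.
  have [tp|tp] := leP t pi; first by apply: h0; lra.
  have := oddpi (t - pi) y.
  have -> : pi + (t - pi) = t by ring.
  have -> : pi - (t - pi) = - (t - 2 * pi) by ring.
  move=> ->; last first.
    by rewrite lt_min !ltr_norml; apply/andP; split; apply/andP; split; lra.
  have [u0|u0] := leP (t - 2 * pi) 0.
    by rewrite h0 ?oppr0 //; lra.
  suff -> : h (- (t - 2 * pi)) y = 0 by rewrite oppr0.
  apply: neg; rewrite ?opprK; first by lra.
  apply: IH; first by lra.
  by move: tm; rewrite -natr1 mulrDl mul1r; lra.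
have posA t y : 0 <= t < pi + del -> h t y = 0.
  move=> ts; apply: (pos (Num.truncn t).+1) => //.
  have t0 : 0 <= t by case/andP: ts.
  have /andP[_ tr] := truncn_itv t0.
  have : (Num.truncn t).+1%:R * 1 <= (Num.truncn t).+1%:R * pi :> R.
    by rewrite ler_wpM2l //; lra.
  by rewrite mulr1; apply: le_trans; exact: ltW.
move=> t y ts; have [t0|t0] := leP 0 t; first by apply: posA; lra.
by apply: neg => //; apply: posA; lra.
Qed.

Theorem corollary5 (R : realType) (d N : nat) (delta : R)
    (h : R -> 'rV[R]_d -> Rcomplex R)
    (hd : (1 <= d)%N) (hN : (1 <= N)%N) (hdelta : 0 < delta)
    (h_polyharmonic :
      polyharmonic N (on_joint h) (strip (- pi - delta) (pi + delta)))
    (h_odd0 : odd_at (- pi - delta) (pi + delta) h 0)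
    (h_oddpi : odd_at (- pi - delta) (pi + delta) h pi)
    (h_oddNpi : odd_at (- pi - delta) (pi + delta) h (- pi))
    (h_growth : le_little_o
      (fun y => ereal_sup
        [set (`|(t * (pi ^+ 2 - t ^+ 2)) *: h t y|)%:E | t in `[- pi, pi]])
      (fun r => r `^ ((1 - d%:R) / 2) * expR r)) :
  forall (t : R) (y : 'rV[R]_d), - pi - delta < t < pi + delta -> h t y = 0.
Proof.
apply: odd_periodic_eq0 => // t y t0pi.
have Re_le (z : Rcomplex R) : `|complex.Re z| <= `|z|.
  case: z => a b; rewrite -(sqrtr_sqr a); apply: ler_wsqrtr.
  by rewrite lerDl sqr_ge0.
have Im_le (z : Rcomplex R) : `|complex.Im z| <= `|z|.
  case: z => a b; rewrite -(sqrtr_sqr b); apply: ler_wsqrtr.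
  by rewrite lerDr sqr_ge0.
have Re0 := component_eq0 (phi := @complex.Re R : {linear Rcomplex R -> R})
  hd hdelta Re_le h_polyharmonic h_odd0 h_oddpi h_growth y t0pi.
have Im0 := component_eq0 (phi := @complex.Im R : {linear Rcomplex R -> R})
  hd hdelta Im_le h_polyharmonic h_odd0 h_oddpi h_growth y t0pi.
by move: Re0 Im0; case: (h t y) => a b /= -> ->.
Qed.
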